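(* (Generalized Smash Nilpotence) Let $R$ be a commutative noetherian ring. Let $f:X\to Y$ be a morphism in $\mathsf{K}^-(R)$ with $Y\in\mathsf{K}^b(\operatorname{proj}R)$. Suppose that $f\otimes_R\kappa(\mathfrak p)=0$ for all $\mathfrak p\in\operatorname{Spec}R$. Then $f^{\otimes t}=0$ in $\mathsf{K}^-(R)$ for some integer $t>0$.
   Context: $\mathsf{K}^-(R)$ (resp. $\mathsf{K}^b(\operatorname{proj}R)$) is the homotopy category of cochain complexes $P$ of finitely generated projective $R$-modules with $P^i=0$ for all $i\gg0$ (resp. $|i|\gg0$). $\kappa(\mathfrak p)=R_{\mathfrak p}/\mathfrak pR_{\mathfrak p}$; the condition $f\otimes_R\kappa(\mathfrak p)=0$ means that the induced morphism $X\otimes_R\kappa(\mathfrak p)\to Y\otimes_R\kappa(\mathfrak p)$ is zero in the homotopy (equivalently derived) category of complexes of $\kappa(\mathfrak p)$-vector spaces. $f^{\otimes t}:X^{\otimes t}\to Y^{\otimes t}$ is the $t$-fold tensor product $f\otimes_R\cdots\otimes_Rf$. *)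

(* Defs.v *)
From HB Require Import structures.
From mathcomp Require Import all_boot all_order all_algebra.
From mathcomp Require Import ring.
From mathcomp Require Import finmap.
From mathcomp Require Import mathcomp_extra boolp classical_sets functions.
From mathcomp Require Import cardinality fsbigop.

Set Implicit Arguments.
Unset Strict Implicit.
Unset Printing Implicit Defensive.

Import GRing.Theory.

Local Open Scope ring_scope.
Local Open Scope quotient_scope.
Local Open Scope classical_set_scope.

Section Ideals.
Variable R : comPzRingType.

Definition is_ideal (I : set R) : Prop :=
  [/\ I 0, forall x y, I x -> I y -> I (x + y) & forall a x, I x -> I (a * x)].

Definition fg_ideal (I : set R) : Prop :=
  exists n (v : 'I_n -> R),
    I = [set x | exists c : 'I_n -> R, x = \sum_i c i * v i].

Definition is_prime (p : set R) : Prop :=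
  [/\ is_ideal p, ~ p 1 & forall x y, p (x * y) -> p x \/ p y].

End Ideals.

Definition noetherian (R : comPzRingType) : Prop :=
  forall I : set R, is_ideal I -> fg_ideal I.

Record Spec (R : comPzRingType) := MkSpec {
  prime_set :> R -> Prop;
  primeP : is_prime prime_set }.

Section Localization.
Variables (R : comPzRingType) (p : Spec R).

Record denom := MkDenom { dval : R; denomP : ~ p dval }.
HB.instance Definition _ := gen_eqMixin denom.
HB.instance Definition _ := gen_choiceMixin denom.

Lemma denom1_subproof : ~ p 1.
Proof. by have [] := primeP p. Qed.

Definition denom1 : denom := MkDenom denom1_subproof.

Lemma denomM_subproof (s t : denom) : ~ p (dval s * dval t).
Proof.
move=> pst; have [_ _ pP] := primeP p.
by have [/denomP|/denomP] := pP _ _ pst.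
Qed.

Definition denomM (s t : denom) : denom := MkDenom (@denomM_subproof s t).

Definition loc_equiv_def (x y : R * denom) : bool :=
  `[< exists u : denom, dval u * (x.1 * dval y.2) = dval u * (y.1 * dval x.2) >].

Lemma loc_equivP x y :
  reflect (exists u : denom, dval u * (x.1 * dval y.2) = dval u * (y.1 * dval x.2))
          (loc_equiv_def x y).
Proof. exact: asboolP. Qed.

Lemma loc_equiv_refl : reflexive loc_equiv_def.
Proof. by move=> x; apply/loc_equivP; exists denom1. Qed.

Lemma loc_equiv_sym : symmetric loc_equiv_def.
Proof. by move=> x y; apply/loc_equivP/loc_equivP => -[u e]; exists u. Qed.

Lemma loc_equiv_trans : transitive loc_equiv_def.
Proof.
move=> y x z /loc_equivP[u e1] /loc_equivP[v e2]; apply/loc_equivP.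
exists (denomM (denomM u v) y.2) => /=.
transitivity (dval v * dval z.2 * (dval u * (x.1 * dval y.2))); first by ring.
rewrite e1; transitivity (dval u * dval x.2 * (dval v * (y.1 * dval z.2))).
  by ring.
by rewrite e2; ring.
Qed.

Canonical loc_equiv :=
  EquivRel loc_equiv_def loc_equiv_refl loc_equiv_sym loc_equiv_trans.

(* R_p *)
Definition loc : Type := {eq_quot loc_equiv}.
HB.instance Definition _ : EqQuotient _ loc_equiv loc := EqQuotient.on loc.
HB.instance Definition _ := Choice.on loc.

Definition frac (a : R) (s : denom) : loc := \pi_loc (a, s).

Lemma fracP a s b t : frac a s = frac b t <->
  exists u : denom, dval u * (a * dval t) = dval u * (b * dval s).
Proof.
rewrite /frac; split; first by move=> /eqmodP/loc_equivP.
by move=> h; apply/eqmodP/loc_equivP.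
Qed.

Lemma loc_ind (P : loc -> Prop) :
  (forall a s, P (frac a s)) -> forall x, P x.
Proof. by move=> h x; rewrite -[x]reprK; case: (repr x) => a s; apply: h. Qed.

Lemma frac_repr (x : loc) : frac (repr x).1 (repr x).2 = x.
Proof. by rewrite /frac -surjective_pairing reprK. Qed.

Definition loc_zero : loc := frac 0 denom1.
Definition loc_one : loc := frac 1 denom1.
Definition loc_opp (x : loc) : loc := frac (- (repr x).1) (repr x).2.
Definition loc_add (x y : loc) : loc :=
  let: (a, s) := repr x in let: (b, t) := repr y in
  frac (a * dval t + b * dval s) (denomM s t).
Definition loc_mul (x y : loc) : loc :=
  let: (a, s) := repr x in let: (b, t) := repr y in
  frac (a * b) (denomM s t).

Lemma loc_oppE a s : loc_opp (frac a s) = frac (- a) s.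
Proof.
rewrite /loc_opp; have /fracP[u e] := frac_repr (frac a s).
by apply/fracP; exists u; rewrite !mulNr !mulrN e.
Qed.

Lemma loc_addE a s b t :
  loc_add (frac a s) (frac b t) = frac (a * dval t + b * dval s) (denomM s t).
Proof.
rewrite /loc_add.
have := frac_repr (frac a s); have := frac_repr (frac b t).
case: (repr (frac a s)) (repr (frac b t)) => [a' s'] [b' t'] /=.
move=> /fracP[v e2] /fracP[u e1]; apply/fracP; exists (denomM u v) => /=.
transitivity (dval u * (a' * dval s) * (dval v * dval t * dval t')
  + dval v * (b' * dval t) * (dval u * dval s * dval s')); first by ring.
by rewrite e1 e2; ring.
Qed.

Lemma loc_mulE a s b t :
  loc_mul (frac a s) (frac b t) = frac (a * b) (denomM s t).
Proof.
rewrite /loc_mul.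
have := frac_repr (frac a s); have := frac_repr (frac b t).
case: (repr (frac a s)) (repr (frac b t)) => [a' s'] [b' t'] /=.
move=> /fracP[v e2] /fracP[u e1]; apply/fracP; exists (denomM u v) => /=.
transitivity (dval u * (a' * dval s) * (dval v * (b' * dval t))); first by ring.
by rewrite e1 e2; ring.
Qed.

Fact loc_addA : associative loc_add.
Proof.
elim/loc_ind => a s; elim/loc_ind => b t; elim/loc_ind => c u.
by rewrite !loc_addE; apply/fracP; exists denom1; rewrite /=; ring.
Qed.

Fact loc_addC : commutative loc_add.
Proof.
elim/loc_ind => a s; elim/loc_ind => b t.
by rewrite !loc_addE; apply/fracP; exists denom1; rewrite /=; ring.
Qed.

Fact loc_add0 : left_id loc_zero loc_add.
Proof.
elim/loc_ind => a s.
by rewrite loc_addE; apply/fracP; exists denom1; rewrite /=; ring.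
Qed.

Fact loc_addN : left_inverse loc_zero loc_opp loc_add.
Proof.
elim/loc_ind => a s.
by rewrite loc_oppE loc_addE; apply/fracP; exists denom1; rewrite /=; ring.
Qed.

HB.instance Definition _ :=
  GRing.isZmodule.Build loc loc_addA loc_addC loc_add0 loc_addN.

Fact loc_mulA : associative loc_mul.
Proof.
elim/loc_ind => a s; elim/loc_ind => b t; elim/loc_ind => c u.
by rewrite !loc_mulE; apply/fracP; exists denom1; rewrite /=; ring.
Qed.

Fact loc_mulC : commutative loc_mul.
Proof.
elim/loc_ind => a s; elim/loc_ind => b t.
by rewrite !loc_mulE; apply/fracP; exists denom1; rewrite /=; ring.
Qed.

Fact loc_mul1 : left_id loc_one loc_mul.
Proof.
elim/loc_ind => a s.
by rewrite loc_mulE; apply/fracP; exists denom1; rewrite /=; ring.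
Qed.

Fact loc_mulDl : left_distributive loc_mul +%R.
Proof.
elim/loc_ind => a s; elim/loc_ind => b t; elim/loc_ind => c u.
rewrite /GRing.add /= !(loc_mulE, loc_addE).
by apply/fracP; exists denom1; rewrite /=; ring.
Qed.

Fact loc_one_neq0 : loc_one != 0.
Proof.
apply/eqP => /fracP[u /=]; rewrite !mulr1 mulr0 => u0.
by apply: (@denomP u); rewrite u0; have [[]] := primeP p.
Qed.

HB.instance Definition _ := GRing.Zmodule_isComNzRing.Build loc
  loc_mulA loc_mulC loc_mul1 loc_mulDl loc_one_neq0.

Lemma fracD a s b t :
  frac a s + frac b t = frac (a * dval t + b * dval s) (denomM s t).
Proof. exact: loc_addE. Qed.

Lemma fracN a s : - frac a s = frac (- a) s.
Proof. exact: loc_oppE. Qed.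

Lemma fracM a s b t : frac a s * frac b t = frac (a * b) (denomM s t).
Proof. exact: loc_mulE. Qed.

(* p R_p: fractions whose numerator can be chosen in p. *)
Definition loc_max : {pred loc} :=
  [pred x | `[< exists2 a, p a & exists s, x = frac a s >]].

Lemma loc_maxP x :
  reflect (exists2 a, p a & exists s, x = frac a s) (x \in loc_max).
Proof. exact: asboolP. Qed.

Lemma loc_max_frac a s : (frac a s \in loc_max) = `[< p a >].
Proof.
have [[_ _ pM] _ pP] := primeP p.
apply/loc_maxP/asboolP => [[b pb [t /fracP[u e]]]|pa]; last by exists a => //; exists s.
have : p (dval u * (a * dval t)).
  by rewrite e; apply: (pM); rewrite mulrC; apply: (pM).
by move=> /pP[/denomP//|/pP[//|/denomP]].
Qed.

Fact loc_max_closed : idealr_closed loc_max.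
Proof.
have [[p0 pD pM] p1 _] := primeP p; split.
- by apply/loc_maxP; exists 0 => //; exists denom1.
- by rewrite loc_max_frac; apply/asboolP.
- elim/loc_ind => a s; elim/loc_ind => b t; elim/loc_ind => c u.
  rewrite !loc_max_frac => /asboolP pb /asboolP pc.
  rewrite fracM fracD loc_max_frac; apply/asboolP.
  by apply: (pD); rewrite mulrC; apply: (pM) => //; apply: (pM).
Qed.

HB.instance Definition _ := isIdealr.Build loc loc_max loc_max_closed.

Definition kappa : Type := {ideal_quot loc_max}.
HB.instance Definition _ := GRing.ComNzRing.on kappa.

Definition to_kappa (a : R) : kappa := \pi_{ideal_quot loc_max} (frac a denom1).

Fact to_kappa_zmod : zmod_morphism to_kappa.
Proof.
move=> a b; rewrite /to_kappa -rmorphB /=; congr (\pi _).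
by rewrite fracN fracD; apply/fracP; exists denom1; rewrite /=; ring.
Qed.

Fact to_kappa_monoid : monoid_morphism to_kappa.
Proof.
split=> [|a b]; first exact: (rmorph1 (\pi_{ideal_quot loc_max})).
rewrite /to_kappa -rmorphM /=; congr (\pi _).
by rewrite fracM; apply/fracP; exists denom1; rewrite /=; ring.
Qed.

HB.instance Definition _ :=
  GRing.isZmodMorphism.Build R kappa to_kappa to_kappa_zmod.
HB.instance Definition _ :=
  GRing.isMonoidMorphism.Build R kappa to_kappa to_kappa_monoid.

Lemma to_kappa_eq0 a : to_kappa a = 0 <-> p a.
Proof.
rewrite /to_kappa -(rmorph0 (\pi_{ideal_quot loc_max})).
split; first by move=> /eqP; rewrite -Quotient.idealrBE subr0 loc_max_frac => /asboolP.
by move=> pa; apply/eqP; rewrite -Quotient.idealrBE subr0 loc_max_frac; apply/asboolP.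
Qed.

Lemma kappa_field (x : kappa) : x != 0 -> exists y, x * y = 1.
Proof.
rewrite -[x]reprK; elim/loc_ind: (repr x) => a s.
rewrite -(rmorph0 (\pi_{ideal_quot loc_max})) -Quotient.idealrBE subr0.
rewrite loc_max_frac => /asboolP na.
exists (\pi_{ideal_quot loc_max} (frac (dval s) (MkDenom na))).
rewrite -rmorphM -(rmorph1 (\pi_{ideal_quot loc_max})) fracM.
by congr (\pi _); apply/fracP; exists denom1; rewrite /=; ring.
Qed.

End Localization.

Section TensorProduct.
Variables (R : comPzRingType) (M N : lmodType R).

Record bilin (P : lmodType R) := MkBilin {
  bilin_fun :> M -> N -> P;
  bilin_linl : forall n, linear (bilin_fun^~ n);
  bilin_linr : forall m, linear (bilin_fun m) }.

Section BilinTheory.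
Variables (P : lmodType R) (b : bilin P).

Lemma bilinDl m m' n : b (m + m') n = b m n + b m' n.
Proof. by have := bilin_linl b n 1 m m'; rewrite !scale1r. Qed.

Lemma bilin0l n : b 0 n = 0.
Proof. by apply: (addrI (b 0 n)); rewrite -bilinDl !addr0. Qed.

Lemma bilinZl a m n : b (a *: m) n = a *: b m n.
Proof. by have := bilin_linl b n a m 0; rewrite addr0 bilin0l addr0. Qed.

Lemma bilinDr m n n' : b m (n + n') = b m n + b m n'.
Proof. by have := bilin_linr b m 1 n n'; rewrite !scale1r. Qed.

Lemma bilin0r m : b m 0 = 0.
Proof. by apply: (addrI (b m 0)); rewrite -bilinDr !addr0. Qed.

Lemma bilinZr a m n : b m (a *: n) = a *: b m n.
Proof. by have := bilin_linr b m a n 0; rewrite addr0 bilin0r addr0. Qed.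

Definition bilin_eval (s : seq (M * N)) : P := \sum_(u <- s) b u.1 u.2.

End BilinTheory.

(* M (x) N: finite formal sums of pairs (m, n), two of them being identified
   when every bilinear map out of M * N takes the same value on both; this is
   the quotient by the bilinearity relations, and its universal property is
   [tens_liftE] together with [tens_ext] below. *)
Definition tens_equiv_def (s t : seq (M * N)) : bool :=
  `[< forall (P : lmodType R) (b : bilin P), bilin_eval b s = bilin_eval b t >].

Lemma tens_equivP s t :
  reflect (forall P (b : bilin P), bilin_eval b s = bilin_eval b t)
          (tens_equiv_def s t).
Proof. exact: asboolP. Qed.

Lemma tens_equiv_refl : reflexive tens_equiv_def.
Proof. by move=> s; apply/tens_equivP. Qed.

Lemma tens_equiv_sym : symmetric tens_equiv_def.
Proof. by move=> s t; apply/tens_equivP/tens_equivP => h P b; rewrite h. Qed.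

Lemma tens_equiv_trans : transitive tens_equiv_def.
Proof.
move=> t s u /tens_equivP h1 /tens_equivP h2; apply/tens_equivP => P b.
by rewrite h1 h2.
Qed.

Canonical tens_equiv :=
  EquivRel tens_equiv_def tens_equiv_refl tens_equiv_sym tens_equiv_trans.

Definition tens : Type := {eq_quot tens_equiv}.
HB.instance Definition _ : EqQuotient _ tens_equiv tens := EqQuotient.on tens.
HB.instance Definition _ := Choice.on tens.

Definition tens_eval (P : lmodType R) (b : bilin P) (x : tens) : P :=
  bilin_eval b (repr x).

Lemma tens_eval_pi P (b : bilin P) s :
  tens_eval b (\pi_tens s) = bilin_eval b s.
Proof.
have /eqmodP/tens_equivP : \pi_tens (repr (\pi_tens s)) = \pi_tens s.
  by rewrite reprK.
exact.
Qed.

Lemma tens_eval_inj (x y : tens) :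
  (forall P (b : bilin P), tens_eval b x = tens_eval b y) -> x = y.
Proof.
move=> h; rewrite -[x]reprK -[y]reprK.
by apply/eqmodP/tens_equivP => P b; apply: h.
Qed.

Definition tens_zero : tens := \pi_tens [::].
Definition tens_add (x y : tens) : tens := \pi_tens (repr x ++ repr y).
Definition tens_scale (a : R) (x : tens) : tens :=
  \pi_tens [seq (a *: u.1, u.2) | u <- repr x].
Definition tens_opp (x : tens) : tens := tens_scale (-1) x.

Lemma tens_eval_zero P (b : bilin P) : tens_eval b tens_zero = 0.
Proof. by rewrite tens_eval_pi /bilin_eval big_nil. Qed.

Lemma tens_eval_add P (b : bilin P) x y :
  tens_eval b (tens_add x y) = tens_eval b x + tens_eval b y.
Proof. by rewrite tens_eval_pi /bilin_eval big_cat. Qed.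

Lemma tens_eval_scale P (b : bilin P) a x :
  tens_eval b (tens_scale a x) = a *: tens_eval b x.
Proof.
rewrite tens_eval_pi /tens_eval /bilin_eval big_map scaler_sumr.
by apply: eq_bigr => u _; rewrite bilinZl.
Qed.

Let tens_evalE := (tens_eval_zero, tens_eval_add, tens_eval_scale).

Fact tens_addA : associative tens_add.
Proof. by move=> x y z; apply: tens_eval_inj => P b; rewrite !tens_evalE addrA. Qed.

Fact tens_addC : commutative tens_add.
Proof. by move=> x y; apply: tens_eval_inj => P b; rewrite !tens_evalE addrC. Qed.

Fact tens_add0 : left_id tens_zero tens_add.
Proof. by move=> x; apply: tens_eval_inj => P b; rewrite !tens_evalE add0r. Qed.

Fact tens_addN : left_inverse tens_zero tens_opp tens_add.
Proof.
by move=> x; apply: tens_eval_inj => P b; rewrite !tens_evalE scaleN1r addNr.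
Qed.

HB.instance Definition _ :=
  GRing.isZmodule.Build tens tens_addA tens_addC tens_add0 tens_addN.

Fact tens_scaleA a c x : tens_scale a (tens_scale c x) = tens_scale (a * c) x.
Proof. by apply: tens_eval_inj => P b; rewrite !tens_evalE scalerA. Qed.

Fact tens_scale1 : left_id 1 tens_scale.
Proof. by move=> x; apply: tens_eval_inj => P b; rewrite !tens_evalE scale1r. Qed.

Fact tens_scaleDr : right_distributive tens_scale +%R.
Proof.
by move=> a x y; apply: tens_eval_inj => P b; rewrite !tens_evalE scalerDr.
Qed.

Fact tens_scaleDl x : {morph tens_scale^~ x : a c / a + c}.
Proof.
by move=> a c; apply: tens_eval_inj => P b; rewrite !tens_evalE scalerDl.
Qed.

HB.instance Definition _ := GRing.Zmodule_isLmodule.Build R tens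
  tens_scaleA tens_scale1 tens_scaleDr tens_scaleDl.

Definition pure (m : M) (n : N) : tens := \pi_tens [:: (m, n)].

Lemma tens_eval_pure P (b : bilin P) m n : tens_eval b (pure m n) = b m n.
Proof. by rewrite tens_eval_pi /bilin_eval big_seq1. Qed.

Fact pure_linl n : linear (pure^~ n).
Proof.
move=> a m m'; apply: tens_eval_inj => P b.
by rewrite tens_eval_add tens_eval_scale !tens_eval_pure bilinDl bilinZl.
Qed.

Fact pure_linr m : linear (pure m).
Proof.
move=> a n n'; apply: tens_eval_inj => P b.
by rewrite tens_eval_add tens_eval_scale !tens_eval_pure bilinDr bilinZr.
Qed.

Definition pure_bilin : bilin tens := MkBilin pure_linl pure_linr.

Lemma pure0l n : pure 0 n = 0. Proof. exact: (bilin0l pure_bilin). Qed.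
Lemma pure0r m : pure m 0 = 0. Proof. exact: (bilin0r pure_bilin). Qed.
Lemma pureDl m m' n : pure (m + m') n = pure m n + pure m' n.
Proof. exact: (bilinDl pure_bilin). Qed.
Lemma pureDr m n n' : pure m (n + n') = pure m n + pure m n'.
Proof. exact: (bilinDr pure_bilin). Qed.
Lemma pureZl a m n : pure (a *: m) n = a *: pure m n.
Proof. exact: (bilinZl pure_bilin). Qed.
Lemma pureZr a m n : pure m (a *: n) = a *: pure m n.
Proof. exact: (bilinZr pure_bilin). Qed.

Definition tens_lift (P : lmodType R) (b : bilin P) : tens -> P := tens_eval b.

Fact tens_lift_linear P (b : bilin P) : linear (tens_lift b).
Proof. by move=> a x y; rewrite /tens_lift tens_eval_add tens_eval_scale. Qed.

HB.instance Definition _ P (b : bilin P) :=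
  GRing.isLinear.Build R tens P *:%R (tens_lift b) (tens_lift_linear b).

Lemma tens_liftE P (b : bilin P) m n : tens_lift b (pure m n) = b m n.
Proof. exact: tens_eval_pure. Qed.

Lemma tens_sum (x : tens) : x = \sum_(u <- repr x) pure u.1 u.2.
Proof.
rewrite -[LHS]reprK; elim: (repr x) => [|[m n] s IH]; first by rewrite big_nil.
rewrite big_cons -IH; apply: tens_eval_inj => P b.
by rewrite tens_eval_add tens_eval_pure !tens_eval_pi /bilin_eval big_cons.
Qed.

Lemma tens_ext (P : lmodType R) (f g : {linear tens -> P}) :
  (forall m n, f (pure m n) = g (pure m n)) -> f =1 g.
Proof.
move=> h x; rewrite [x]tens_sum !linear_sum.
by apply: eq_bigr => u _; apply: h.
Qed.

End TensorProduct.

Section TensorMap.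
Variables (R : comPzRingType) (M M' N N' : lmodType R).
Variables (f : {linear M -> M'}) (g : {linear N -> N'}).

Definition tens_map_fun (m : M) (n : N) : tens M' N' := pure (f m) (g n).

Fact tens_map_linl n : linear (tens_map_fun^~ n).
Proof. by move=> a m m'; rewrite /tens_map_fun linearP pure_linl. Qed.

Fact tens_map_linr m : linear (tens_map_fun m).
Proof. by move=> a n n'; rewrite /tens_map_fun linearP pure_linr. Qed.

Definition tens_map : tens M N -> tens M' N' :=
  tens_lift (MkBilin tens_map_linl tens_map_linr).

HB.instance Definition _ := GRing.Linear.on tens_map.

Lemma tens_mapE m n : tens_map (pure m n) = pure (f m) (g n).
Proof. exact: tens_liftE. Qed.

End TensorMap.

Section BaseChange.
Variables (R S : comPzRingType) (phi : {rmorphism R -> S}).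

(* S as an R-module through phi; the dummy abstraction keeps phi in the type so
   that the module structure can be inferred from it. *)
Definition restr : Type := (fun _ : {rmorphism R -> S} => S : Type) phi.
HB.instance Definition _ := GRing.Zmodule.on restr.

Definition restr_scale (a : R) (x : restr) : restr := phi a * (x : S).

Fact restr_scaleA a c x : restr_scale a (restr_scale c x) = restr_scale (a * c) x.
Proof. by rewrite /restr_scale rmorphM mulrA. Qed.

Fact restr_scale1 : left_id 1 restr_scale.
Proof. by move=> x; rewrite /restr_scale rmorph1 mul1r. Qed.

Fact restr_scaleDr : right_distributive restr_scale +%R.
Proof. by move=> a x y; rewrite /restr_scale mulrDr. Qed.

Fact restr_scaleDl x : {morph restr_scale^~ x : a c / a + c}.
Proof. by move=> a c; rewrite /restr_scale rmorphD mulrDl. Qed.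

HB.instance Definition _ := GRing.Zmodule_isLmodule.Build R restr
  restr_scaleA restr_scale1 restr_scaleDr restr_scaleDl.

Definition restr_mul (s : S) (x : restr) : restr := s * (x : S).

Fact restr_mul_linear s : linear (restr_mul s).
Proof.
move=> a x y; rewrite /restr_mul mulrDr; congr (_ + _).
by rewrite /GRing.scale /= /restr_scale mulrCA.
Qed.

HB.instance Definition _ s :=
  GRing.isLinear.Build R restr restr *:%R (restr_mul s) (restr_mul_linear s).

(* M (x)_R S with S acting on the right-hand factor *)
Definition bchg (M : lmodType R) : Type := tens M restr.
HB.instance Definition _ M := GRing.Zmodule.on (bchg M).

Section Module.
Variable M : lmodType R.

Definition bchg_scale (s : S) : bchg M -> bchg M :=
  tens_map (idfun : {linear M -> M}) (restr_mul s).

Lemma bchg_scale_pure s (m : M) (x : restr) :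
  bchg_scale s (pure m x) = pure m (restr_mul s x).
Proof. exact: tens_mapE. Qed.

Lemma bchg_ind (P : bchg M -> Prop) : P 0 ->
  (forall x y, P x -> P y -> P (x + y)) ->
  (forall m (s : restr), P (pure m s)) -> forall x, P x.
Proof.
move=> P0 PD Pp x; rewrite [x]tens_sum.
by apply: big_ind => // u _; apply: Pp.
Qed.

Fact bchg_scaleDr : right_distributive bchg_scale +%R.
Proof. by move=> s x y; rewrite /bchg_scale linearD. Qed.

Fact bchg_scale0 s : bchg_scale s 0 = 0.
Proof. by rewrite /bchg_scale linear0. Qed.

Fact bchg_scaleA s t x : bchg_scale s (bchg_scale t x) = bchg_scale (s * t) x.
Proof.
elim/bchg_ind: x => [|x y hx hy|m x]; first by rewrite !bchg_scale0.
  by rewrite !bchg_scaleDr hx hy.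
by rewrite !bchg_scale_pure /restr_mul mulrA.
Qed.

Fact bchg_scale1 : left_id 1 bchg_scale.
Proof.
elim/bchg_ind => [|x y hx hy|m x]; first by rewrite !bchg_scale0.
  by rewrite !bchg_scaleDr hx hy.
by rewrite !bchg_scale_pure /restr_mul mul1r.
Qed.

Fact bchg_scaleDl x : {morph bchg_scale^~ x : s t / s + t}.
Proof.
move=> s t; elim/bchg_ind: x => [|x y hx hy|m x].
- by rewrite !bchg_scale0 addr0.
- by rewrite !bchg_scaleDr hx hy addrACA.
rewrite !bchg_scale_pure; have := pure_linr m 1 (restr_mul s x) (restr_mul t x).
by rewrite !scale1r => <-; rewrite /restr_mul mulrDl.
Qed.

HB.instance Definition _ := GRing.Zmodule_isLmodule.Build S (bchg M)
  bchg_scaleA bchg_scale1 bchg_scaleDr bchg_scaleDl.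

End Module.

Section Map.
Variables (M N : lmodType R) (f : {linear M -> N}).

Definition bchg_map : bchg M -> bchg N := tens_map f (idfun : {linear restr -> restr}).

Lemma bchg_map_pure (m : M) (x : restr) : bchg_map (pure m x) = pure (f m) x.
Proof. exact: tens_mapE. Qed.

Fact bchg_mapD x y : bchg_map (x + y) = bchg_map x + bchg_map y.
Proof. by rewrite /bchg_map linearD. Qed.

Fact bchg_map0 : bchg_map 0 = 0.
Proof. by rewrite /bchg_map linear0. Qed.

Fact bchg_map_linear : linear bchg_map.
Proof.
move=> s x y; rewrite bchg_mapD; congr (_ + _); rewrite /GRing.scale /=.
elim/bchg_ind: x => [|x x' hx hy|m x].
- by rewrite !(bchg_map0, bchg_scale0).
- by rewrite !(bchg_mapD, bchg_scaleDr) hx hy.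
by rewrite !(bchg_scale_pure, bchg_map_pure).
Qed.

HB.instance Definition _ :=
  GRing.isLinear.Build S (bchg M) (bchg N) *:%R bchg_map bchg_map_linear.

End Map.

End BaseChange.

Arguments bchg_map {R S} phi {M N} f x.

Section DirectSum.
Variables (R : comPzRingType) (I : choiceType) (V : I -> lmodType R).

Record dsum := MkDsum {
  dsum_fun :> forall i, V i;
  dsum_fin : finite_set [set i | dsum_fun i != 0] }.

HB.instance Definition _ := gen_eqMixin dsum.
HB.instance Definition _ := gen_choiceMixin dsum.

Lemma dsumP (x y : dsum) : (forall i, x i = y i) -> x = y.
Proof.
case: x y => [x px] [y py] /= exy.
have {}exy : x = y by apply: functional_extensionality_dep.
by subst y; congr MkDsum; apply: Prop_irrelevance.
Qed.

Fact dsum_zero_fin : finite_set [set i | (0 : V i) != 0].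
Proof.
by apply: (sub_finite_set (B := set0)) => // i /=; rewrite eqxx.
Qed.
Definition dsum_zero : dsum := MkDsum dsum_zero_fin.

Fact dsum_add_fin (x y : dsum) : finite_set [set i | x i + y i != 0].
Proof.
apply: (sub_finite_set (B := [set i | x i != 0] `|` [set i | y i != 0])).
  move=> i /=; case: (eqVneq (x i) 0) => [->|]; last by left.
  by rewrite add0r; right.
by rewrite finite_setU; split; apply: dsum_fin.
Qed.
Definition dsum_add (x y : dsum) : dsum := MkDsum (dsum_add_fin x y).

Fact dsum_scale_fin (a : R) (x : dsum) : finite_set [set i | a *: x i != 0].
Proof.
apply: sub_finite_set (dsum_fin x) => i /=; apply: contra_neq => ->.
by rewrite scaler0.
Qed.
Definition dsum_scale (a : R) (x : dsum) : dsum := MkDsum (dsum_scale_fin a x).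

Definition dsum_opp (x : dsum) : dsum := dsum_scale (-1) x.

Fact dsum_addA : associative dsum_add.
Proof. by move=> x y z; apply: dsumP => i /=; rewrite addrA. Qed.

Fact dsum_addC : commutative dsum_add.
Proof. by move=> x y; apply: dsumP => i /=; rewrite addrC. Qed.

Fact dsum_add0 : left_id dsum_zero dsum_add.
Proof. by move=> x; apply: dsumP => i /=; rewrite add0r. Qed.

Fact dsum_addN : left_inverse dsum_zero dsum_opp dsum_add.
Proof. by move=> x; apply: dsumP => i /=; rewrite scaleN1r addNr. Qed.

HB.instance Definition _ :=
  GRing.isZmodule.Build dsum dsum_addA dsum_addC dsum_add0 dsum_addN.

Fact dsum_scaleA a c x : dsum_scale a (dsum_scale c x) = dsum_scale (a * c) x.
Proof. by apply: dsumP => i /=; rewrite scalerA. Qed.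

Fact dsum_scale1 : left_id 1 dsum_scale.
Proof. by move=> x; apply: dsumP => i /=; rewrite scale1r. Qed.

Fact dsum_scaleDr : right_distributive dsum_scale +%R.
Proof. by move=> a x y; apply: dsumP => i /=; rewrite scalerDr. Qed.

Fact dsum_scaleDl x : {morph dsum_scale^~ x : a c / a + c}.
Proof. by move=> a c; apply: dsumP => i /=; rewrite scalerDl. Qed.

HB.instance Definition _ := GRing.Zmodule_isLmodule.Build R dsum
  dsum_scaleA dsum_scale1 dsum_scaleDr dsum_scaleDl.

Lemma dsum0E i : (0 : dsum) i = 0. Proof. by []. Qed.
Lemma dsumDE (x y : dsum) i : (x + y) i = x i + y i. Proof. by []. Qed.
Lemma dsumZE a (x : dsum) i : (a *: x) i = a *: x i. Proof. by []. Qed.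

Fact dsum_inj_fin (i : I) (v : V i) :
  finite_set [set j | eqtype.dfwith (fun j => 0 : V j) v j != 0].
Proof.
apply: (sub_finite_set (B := [set i])) => [j /=|]; last exact: finite_set1.
by case: eqtype.dfwithP => //= k ik; rewrite eqxx.
Qed.

Definition dsum_inj (i : I) (v : V i) : dsum := MkDsum (dsum_inj_fin v).

Lemma dsum_injE (i : I) (v : V i) : dsum_inj v i = v.
Proof. by rewrite /= eqtype.dfwith_in. Qed.

Lemma dsum_inj_out (i j : I) (v : V i) : i != j -> dsum_inj v j = 0.
Proof. by move=> ij; rewrite /= eqtype.dfwith_out. Qed.

Fact dsum_inj_linear i : linear (@dsum_inj i).
Proof.
move=> a v w; apply: dsumP => j; rewrite dsumDE dsumZE.
have [<-|ij] := eqVneq i j; first by rewrite !dsum_injE.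
by rewrite !dsum_inj_out // scaler0 addr0.
Qed.

HB.instance Definition _ i :=
  GRing.isLinear.Build R (V i) dsum *:%R (@dsum_inj i) (@dsum_inj_linear i).

Lemma dsum_sum (x : dsum) (A : {fset I}) : (forall i, i \notin A -> x i = 0) ->
  x = \sum_(i <- A) dsum_inj (x i).
Proof.
move=> hA; apply: dsumP => j.
have E (s : seq I) : (\sum_(i <- s) dsum_inj (x i)) j =
                     \sum_(i <- s) dsum_inj (x i) j.
  by elim: s => [|i s IH]; rewrite ?big_nil // !big_cons dsumDE IH.
rewrite E; have [jA|jA] := boolP (j \in A).
  rewrite (big_fsetD1 j) // dsum_injE big1_fset => [|i]; first exact: esym (addr0 _).
  by rewrite !inE => /andP[ij _] _; rewrite dsum_inj_out.
rewrite hA // big1_fset // => i iA _; rewrite dsum_inj_out //.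
by apply: contraNneq jA => <-.
Qed.

Section Lift.
Variables (P : lmodType R) (g : forall i, {linear V i -> P}).

Definition dsum_lift (x : dsum) : P := \sum_(i \in [set: I]) g i (x i).

Lemma dsum_lift_fset (x : dsum) (A : {fset I}) :
  (forall i, i \notin A -> x i = 0) -> dsum_lift x = \sum_(i <- A) g i (x i).
Proof.
by move=> hA; rewrite /dsum_lift (fsbigTE A) // => i /hA ->; rewrite linear0.
Qed.

Lemma dsum_supp (x : dsum) : exists A : {fset I}, forall i, i \notin A -> x i = 0.
Proof.
exists (fset_set [set i | x i != 0]) => i; rewrite in_fset_set; last exact: dsum_fin.
by apply: contraNeq => ?; rewrite inE.
Qed.

Fact dsum_lift_linear : linear dsum_lift.
Proof.
move=> a x y; have [A hA] := dsum_supp x; have [B hB] := dsum_supp y.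
have hAB i : i \notin (A `|` B)%fset -> x i = 0 /\ y i = 0.
  by rewrite inE negb_or => /andP[/hA -> /hB ->].
have hxy i : i \notin (A `|` B)%fset -> (a *: x + y) i = 0.
  by move=> /hAB[xi yi]; rewrite dsumDE dsumZE xi yi scaler0 addr0.
rewrite (dsum_lift_fset hxy) (@dsum_lift_fset x (A `|` B)%fset); last first.
  by move=> i /hAB[].
rewrite (@dsum_lift_fset y (A `|` B)%fset); last by move=> i /hAB[].
rewrite scaler_sumr -big_split; apply: eq_bigr => i _.
by rewrite dsumDE dsumZE linearP.
Qed.

HB.instance Definition _ :=
  GRing.isLinear.Build R dsum P *:%R dsum_lift dsum_lift_linear.

Lemma dsum_lift_inj i (v : V i) : dsum_lift (dsum_inj v) = g i v.
Proof.
rewrite (@dsum_lift_fset _ [fset i]%fset) ?big_seq_fset1 ?dsum_injE // => j.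
by rewrite inE eq_sym => /dsum_inj_out.
Qed.

End Lift.

Lemma dsum_ext (P : lmodType R) (f g : {linear dsum -> P}) :
  (forall i (v : V i), f (dsum_inj v) = g (dsum_inj v)) -> f =1 g.
Proof.
move=> h x; have [A hA] := dsum_supp x.
by rewrite (dsum_sum hA) !linear_sum; apply: eq_bigr => i _; apply: h.
Qed.

End DirectSum.

Section Modules.
Variables (R : comPzRingType) (M : lmodType R).

Definition fin_gen : Prop :=
  exists n (v : 'I_n -> M), forall x, exists c : 'I_n -> R, x = \sum_i c i *: v i.

Definition projective : Prop :=
  forall (A B : lmodType R) (g : {linear A -> B}) (f : {linear M -> B}),
    (forall b, exists a, g a = b) -> exists h : {linear M -> A}, forall x, g (h x) = f x.

End Modules.

Record complex (R : comPzRingType) := MkComplex {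
  ob :> int -> lmodType R;
  diff : forall i, {linear ob i -> ob (i + 1)};
  diffK : forall i (x : ob i), diff (i + 1) (diff i x) = 0 }.

Record chain_map (R : comPzRingType) (X Y : complex R) := MkChainMap {
  chain_fun :> forall i, {linear X i -> Y i};
  chain_comm : forall i (x : X i),
    chain_fun (i + 1) (diff X i x) = diff Y i (chain_fun i x) }.

(* A morphism of the homotopy category is the homotopy class of a chain map;
   equality of classes is [homotopic]. *)
Section Homotopy.
Variables (R : comPzRingType) (X Y : complex R).

(* Every integer is of the form i + 1, so no degree is left out. *)
Definition homotopic (f g : chain_map X Y) : Prop :=
  exists h : forall i, {linear X (i + 1) -> Y i},
    forall i (x : X (i + 1)),
      f (i + 1) x - g (i + 1) x =
      diff Y i (h i x) + h (i + 1) (diff X (i + 1) x).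

Definition zero_comp (i : int) : {linear X i -> Y i} := \0.

Fact zero_comm i (x : X i) :
  zero_comp (i + 1) (diff X i x) = diff Y i (zero_comp i x).
Proof. by rewrite linear0. Qed.

Definition zero_map : chain_map X Y := MkChainMap zero_comm.

End Homotopy.

Section Boundedness.
Variables (R : comPzRingType) (X : complex R).

Definition in_Kminus : Prop :=
  (forall i, fin_gen (X i) /\ projective (X i)) /\
  exists n : int, forall i, n < i -> forall x : X i, x = 0.

Definition in_Kb : Prop :=
  (forall i, fin_gen (X i) /\ projective (X i)) /\
  exists n : int, forall i, n < `|i| -> forall x : X i, x = 0.

End Boundedness.

Section BaseChangeComplex.
Variables (R S : comPzRingType) (phi : {rmorphism R -> S}).

Section Complex.
Variable X : complex R.

Fact cbchg_diffK i (x : bchg phi (X i)) :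
  bchg_map phi (diff X (i + 1)) (bchg_map phi (diff X i) x) = 0.
Proof.
elim/bchg_ind: x => [|x y hx hy|m s]; first by rewrite !bchg_map0.
  by rewrite !bchg_mapD hx hy addr0.
by rewrite !bchg_map_pure diffK pure0l.
Qed.

Definition cbchg : complex S := @MkComplex S
  (fun i => bchg phi (X i)) (fun i => bchg_map phi (diff X i)) cbchg_diffK.

End Complex.

Section Map.
Variables (X Y : complex R) (f : chain_map X Y).

Fact cbchg_map_comm i (x : bchg phi (X i)) :
  bchg_map phi (f (i + 1)) (bchg_map phi (diff X i) x) =
  bchg_map phi (diff Y i) (bchg_map phi (f i) x).
Proof.
elim/bchg_ind: x => [|x y hx hy|m s]; first by rewrite !bchg_map0.
  by rewrite !bchg_mapD hx hy.
by rewrite !bchg_map_pure chain_comm.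
Qed.

Definition cbchg_map : chain_map (cbchg X) (cbchg Y) := @MkChainMap S
  (cbchg X) (cbchg Y) (fun i => bchg_map phi (f i)) cbchg_map_comm.

End Map.

End BaseChangeComplex.

Definition bideg (n : int) : Type := {ij : int * int | ij.1 + ij.2 == n}.

Section Bideg.
Variables (n : int) (p : bideg n).

Fact bidegl_subproof : ((sval p).1 + 1, (sval p).2).1 + (sval p).2 == n + 1.
Proof. by rewrite /= addrAC (eqP (svalP p)). Qed.

Fact bidegr_subproof : (sval p).1 + ((sval p).1, (sval p).2 + 1).2 == n + 1.
Proof. by rewrite /= addrA (eqP (svalP p)). Qed.

Definition bidegl : bideg (n + 1) :=
  exist (fun ij : int * int => ij.1 + ij.2 == n + 1)
    ((sval p).1 + 1, (sval p).2) bidegl_subproof.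

Definition bidegr : bideg (n + 1) :=
  exist (fun ij : int * int => ij.1 + ij.2 == n + 1)
    ((sval p).1, (sval p).2 + 1) bidegr_subproof.

End Bideg.

Section TensorComplex.
Variables (R : comPzRingType) (X Y : complex R).

(* The direct sum ranges over all pairs (i, j) with i + j = n, so that neither
   differential nor functoriality needs a transport between degrees. *)
Definition tob_summand (n : int) (p : bideg n) : lmodType R :=
  tens (X (sval p).1) (Y (sval p).2).

Definition tob (n : int) : lmodType R := dsum (@tob_summand n).

Section Diff.
Variables (n : int) (p : bideg n).

Definition tdiffl : {linear tob_summand p -> tob (n + 1)} :=
  (@dsum_inj R _ (@tob_summand (n + 1)) (bidegl p))
  \o (tens_map (diff X (sval p).1) (idfun : {linear Y (sval p).2 -> Y (sval p).2})).

Definition tdiffr : {linear tob_summand p -> tob (n + 1)} :=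
  (@dsum_inj R _ (@tob_summand (n + 1)) (bidegr p))
  \o (tens_map (idfun : {linear X (sval p).1 -> X (sval p).1}) (diff Y (sval p).2)).

(* d (x (x) y) = dx (x) y + (-1)^i x (x) dy  for x in degree i *)
Definition tdiff_comp : {linear tob_summand p -> tob (n + 1)} :=
  tdiffl \+ ((-1) ^+ absz (sval p).1 \*: tdiffr).

End Diff.

Definition tdiff (n : int) : {linear tob n -> tob (n + 1)} :=
  dsum_lift (@tdiff_comp n).

Lemma tdiff_inj n (p : bideg n) (z : tob_summand p) :
  tdiff n (dsum_inj z) = tdiff_comp p z.
Proof. exact: dsum_lift_inj. Qed.

Definition tgen n (i j : int) (e : i + j == n) (x : X i) (y : Y j) : tob n :=
  @dsum_inj R _ (@tob_summand n)
    (exist (fun ij : int * int => ij.1 + ij.2 == n) (i, j) e) (pure x y).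

Lemma tgen_irr n (i j : int) (e e' : i + j == n) (x : X i) (y : Y j) :
  tgen e x y = tgen e' x y.
Proof. by rewrite (bool_irrelevance e e'). Qed.

Lemma tgen0l n (i j : int) (e : i + j == n) (y : Y j) : tgen e (0 : X i) y = 0.
Proof. by rewrite /tgen pure0l linear0. Qed.

Lemma tgen0r n (i j : int) (e : i + j == n) (x : X i) : tgen e x (0 : Y j) = 0.
Proof. by rewrite /tgen pure0r linear0. Qed.

Lemma tgen_ext n (P : lmodType R) (f g : {linear tob n -> P}) :
  (forall i j (e : i + j == n) (x : X i) (y : Y j),
    f (tgen e x y) = g (tgen e x y)) -> f =1 g.
Proof.
move=> h; apply: dsum_ext => p.
pose F : {linear tob_summand p -> P} := f \o @dsum_inj R _ (@tob_summand n) p.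
pose G : {linear tob_summand p -> P} := g \o @dsum_inj R _ (@tob_summand n) p.
apply: (@tens_ext R (X (sval p).1) (Y (sval p).2) P F G).
case: p @F @G => -[i j] e F G x y.
exact: h.
Qed.

Lemma tdiff_gen n i j (e : i + j == n) (el : i + 1 + j == n + 1)
    (er : i + (j + 1) == n + 1) (x : X i) (y : Y j) :
  tdiff n (tgen e x y) =
    tgen el (diff X i x) y + (-1) ^+ absz i *: tgen er x (diff Y j y).
Proof.
rewrite tdiff_inj /= !tens_mapE; congr (_ + _ *: _); exact: tgen_irr.
Qed.

Lemma sign_succ (i : int) : (-1) ^+ absz (i + 1) = - (-1) ^+ absz i :> R.
Proof.
case: i => k; first by rewrite -PoszD addn1 exprS mulN1r.
by rewrite NegzE /= -addn1 PoszD opprD addrNK !abszN /= addn1 exprS mulN1r opprK.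
Qed.

Fact tdiffK n (z : tob n) : tdiff (n + 1) (tdiff n z) = 0.
Proof.
apply: (@tgen_ext n _ (tdiff (n + 1) \o tdiff n) (\0 : {linear tob n -> _})).
move=> i j e x y /=.
have el : i + 1 + j == n + 1 by rewrite addrAC (eqP e).
have er : i + (j + 1) == n + 1 by rewrite addrA (eqP e).
have ell : i + 1 + 1 + j == n + 1 + 1 by rewrite addrAC (eqP el).
have elr : i + 1 + (j + 1) == n + 1 + 1 by rewrite addrA (eqP el).
have err : i + (j + 1 + 1) == n + 1 + 1 by rewrite addrA (eqP er).
rewrite (tdiff_gen e el er) linearD linearZ /=.
rewrite (tdiff_gen el ell elr) (tdiff_gen er elr err) !diffK.
rewrite tgen0l tgen0r scaler0 add0r addr0 sign_succ scaleNr.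
exact: addNr.
Qed.

Definition tcomplex : complex R := @MkComplex R tob tdiff tdiffK.

End TensorComplex.

Section TensorChainMap.
Variables (R : comPzRingType) (X X' Y Y' : complex R).
Variables (f : chain_map X X') (g : chain_map Y Y').

Definition tcmap_comp n (p : bideg n) : {linear tob_summand X Y p -> tob X' Y' n} :=
  (@dsum_inj R _ (@tob_summand R X' Y' n) p)
  \o tens_map (f (sval p).1) (g (sval p).2).

Definition tcmap_fun n : {linear tob X Y n -> tob X' Y' n} :=
  dsum_lift (@tcmap_comp n).

Lemma tcmap_gen n i j (e : i + j == n) (x : X i) (y : Y j) :
  tcmap_fun n (tgen e x y) = tgen e (f i x) (g j y).
Proof. by rewrite /tcmap_fun /= dsum_lift_inj /= tens_mapE. Qed.

Fact tcmap_comm n (z : tob X Y n) :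
  tcmap_fun (n + 1) (tdiff X Y n z) = tdiff X' Y' n (tcmap_fun n z).
Proof.
apply: (@tgen_ext _ _ _ n _ (tcmap_fun (n + 1) \o tdiff X Y n)
  (tdiff X' Y' n \o tcmap_fun n)) => i j e x y /=.
have el : i + 1 + j == n + 1 by rewrite addrAC (eqP e).
have er : i + (j + 1) == n + 1 by rewrite addrA (eqP e).
rewrite tcmap_gen !(tdiff_gen e el er) linearD linearZ /= !tcmap_gen.
by rewrite !chain_comm.
Qed.

Definition tcmap : chain_map (tcomplex X Y) (tcomplex X' Y') :=
  @MkChainMap R (tcomplex X Y) (tcomplex X' Y') tcmap_fun tcmap_comm.

End TensorChainMap.

Section UnitComplex.
Variable R : comPzRingType.

(* R concentrated in degree 0: the boolean i == 0 is coerced to a rank. *)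
Definition unit_ob (i : int) : lmodType R := 'rV[R]_(i == 0).

Definition unit_diff (i : int) : {linear unit_ob i -> unit_ob (i + 1)} := \0.

Fact unit_diffK i (x : unit_ob i) : unit_diff (i + 1) (unit_diff i x) = 0.
Proof. by []. Qed.

Definition unit_complex : complex R := @MkComplex R unit_ob unit_diff unit_diffK.

End UnitComplex.

Section Identity.
Variables (R : comPzRingType) (X : complex R).

Definition id_comp (i : int) : {linear X i -> X i} := idfun.

Fact id_comm i (x : X i) :
  id_comp (i + 1) (diff X i x) = diff X i (id_comp i x).
Proof. by []. Qed.

Definition id_map : chain_map X X := MkChainMap id_comm.

End Identity.

(* X, X (x) X, X (x) (X (x) X), ... for t = 1, 2, 3, ... *)
Fixpoint tpow (R : comPzRingType) (X : complex R) (t : nat) : complex R :=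
  match t with
  | 0 => unit_complex R
  | 1 => X
  | t'.+1 => tcomplex X (tpow X t')
  end.

Fixpoint tpow_map (R : comPzRingType) (X Y : complex R) (f : chain_map X Y)
    (t : nat) : chain_map (tpow X t) (tpow Y t) :=
  match t return chain_map (tpow X t) (tpow Y t) with
  | 0 => id_map (unit_complex R)
  | t'.+1 =>
    match t' return chain_map (tpow X t') (tpow Y t') ->
                    chain_map (tpow X t'.+1) (tpow Y t'.+1) with
    | 0 => fun _ => f
    | _.+1 => fun ft => tcmap f ft
    end (tpow_map f t')
  end.

(* Main.v *)
(* Say that a chain map phi is null modulo an ideal I if phi - dh - hd has values
   in I times the target for some homotopy h. Nullity modulo I of f^t and modulo
   J of f^s gives nullity modulo IJ of f^(t+s), so, R being noetherian, an ideal
   maximal among those modulo which no power of f is null is a prime p, if there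
   is one at all. Vanishing of f over the residue field of p gives, after
   clearing denominators, some s outside p with s f null modulo p; maximality
   gives t with f^t null modulo p + (s). Then f^t is modulo p homotopic to s g for
   a chain map g, since the target is s-torsion free modulo p, and f (x) s g =
   (s f) (x) g is null modulo p. So f^(t+1) is null modulo p, a contradiction;
   hence some power of f is null modulo the zero ideal. *)
Require Import Defs.
From HB Require Import structures.
From mathcomp Require Import all_boot all_order all_algebra.
From mathcomp Require Import ring zify.
From mathcomp Require Import finmap.
From mathcomp Require Import mathcomp_extra boolp classical_sets functions.
From mathcomp Require Import cardinality fsbigop.

Set Implicit Arguments.
Unset Strict Implicit.
Unset Printing Implicit Defensive.

Import GRing.Theory.

Local Open Scope ring_scope.
Local Open Scope classical_set_scope.

(** * Submodules of the form $IM$ *)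

Section IdealTimesModule.
Variable R : comPzRingType.

Inductive idmul (I : set R) (M : lmodType R) : M -> Prop :=
| idmul0 : idmul I 0
| idmulD x y : idmul I x -> idmul I y -> idmul I (x + y)
| idmulZ a x : I a -> idmul I (a *: x).

Lemma idmul_scale (I : set R) (M : lmodType R) b (x : M) :
  idmul I x -> idmul I (b *: x).
Proof.
elim=> [|u v _ Iu _ Iv|a u Ia]; first by rewrite scaler0; apply: idmul0.
  by rewrite scalerDr; apply: idmulD.
by rewrite scalerA mulrC -scalerA; apply: idmulZ.
Qed.

Lemma idmulN (I : set R) (M : lmodType R) (x : M) : idmul I x -> idmul I (- x).
Proof. by rewrite -scaleN1r; apply: idmul_scale. Qed.

Lemma idmulB (I : set R) (M : lmodType R) (x y : M) :
  idmul I x -> idmul I y -> idmul I (x - y).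
Proof. by move=> Ix Iy; apply: idmulD => //; apply: idmulN. Qed.

Lemma idmul_sum (I : set R) (M : lmodType R) (T : Type) (r : seq T) (F : T -> M) :
  (forall k, idmul I (F k)) -> idmul I (\sum_(k <- r) F k).
Proof. by move=> h; apply: big_ind => //; [apply: idmul0|apply: idmulD]. Qed.

Lemma idmul_lin (I : set R) (M N : lmodType R) (u : {linear M -> N}) x :
  idmul I x -> idmul I (u x).
Proof.
elim=> [|v w _ Iv _ Iw|a v Ia]; first by rewrite linear0; apply: idmul0.
  by rewrite linearD; apply: idmulD.
by rewrite linearZ; apply: idmulZ.
Qed.

Lemma idmul_scalar (I : set R) (x : R^o) : is_ideal I -> idmul I x -> I x.
Proof.
case=> I0 ID IM; elim=> [|v w _ Iv _ Iw|a v Ia] //; first exact: ID.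
by rewrite /GRing.scale /= mulrC; apply: IM.
Qed.

Lemma idmul_set0 (M : lmodType R) (x : M) : idmul [set 0] x -> x = 0.
Proof.
elim=> [|v w _ -> _ ->|a v /= ->] //; first by rewrite addr0.
by rewrite scale0r.
Qed.

Definition ideal_adjoin (I : set R) (s : R) : set R :=
  [set x | exists2 a, I a & exists r, x = a + r * s].

Lemma ideal_adjoin_ideal I s : is_ideal I -> is_ideal (ideal_adjoin I s).
Proof.
case=> I0 ID IM; split.
- by exists 0 => //; exists 0; rewrite mul0r addr0.
- move=> _ _ [a Ia [r ->]] [b Ib [q ->]]; exists (a + b); first exact: ID.
  by exists (r + q); ring.
- move=> c _ [a Ia [r ->]]; exists (c * a); first exact: IM.
  by exists (c * r); ring.
Qed.

(** On a generator $(a + rs)v$ the witness is $rv$, and witnesses add up. This is division by $s$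
    modulo $I$. *)
Lemma idmul_adjoin (I : set R) s (M : lmodType R) (x : M) :
  idmul (ideal_adjoin I s) x -> exists y, idmul I (x - s *: y).
Proof.
elim=> [|v w _ [y Iy] _ [z Iz]|_ v [a Ia [r ->]]].
- by exists 0; rewrite scaler0 subr0; apply: idmul0.
- by exists (y + z); rewrite scalerDr opprD addrACA; apply: idmulD.
- exists (r *: v); rewrite scalerA (mulrC s) -scalerBl addrK.
  exact: idmulZ.
Qed.

Lemma idmul_pure (I J K : set R) (M N : lmodType R) (x : M) (y : N) :
  (forall a b, I a -> J b -> K (a * b)) ->
  idmul I x -> idmul J y -> idmul K (pure x y).
Proof.
move=> IJK; elim=> [|u v _ IHu _ IHv|a u Ia] Jy.
- by rewrite pure0l; apply: idmul0.
- by rewrite pureDl; apply: idmulD; [apply: IHu|apply: IHv].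
elim: Jy => [|v w _ Hv _ Hw|b v Jb]; first by rewrite pure0r; apply: idmul0.
  by rewrite pureDr; apply: idmulD.
by rewrite pureZl pureZr scalerA; apply: idmulZ; apply: IJK.
Qed.

Lemma idmul_purel (I : set R) (M N : lmodType R) (x : M) (y : N) :
  idmul I x -> idmul I (pure x y).
Proof.
elim=> [|u v _ IHu _ IHv|a u Ia]; first by rewrite pure0l; apply: idmul0.
  by rewrite pureDl; apply: idmulD.
by rewrite pureZl; apply: idmulZ.
Qed.

Lemma idmul_purer (I : set R) (M N : lmodType R) (x : M) (y : N) :
  idmul I y -> idmul I (pure x y).
Proof.
elim=> [|u v _ IHu _ IHv|a u Ia]; first by rewrite pure0r; apply: idmul0.
  by rewrite pureDr; apply: idmulD.
by rewrite pureZr; apply: idmulZ.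
Qed.

End IdealTimesModule.

(** * Projective modules, free covers and dual bases *)

Section Projective.
Variable R : comPzRingType.

Section ScaleVector.
Variables (M : lmodType R) (v : M).
Definition scale_vec (a : R^o) : M := (a : R) *: v.
Fact scale_vec_linear : linear scale_vec.
Proof. by move=> a x y; rewrite /scale_vec scalerDl scalerA. Qed.
HB.instance Definition _ :=
  GRing.isLinear.Build R R^o M *:%R scale_vec scale_vec_linear.
End ScaleVector.

(** The constant family at the regular module: [dsum (@free_mod M)] is the free module on the
    elements of $M$. *)
Definition free_mod (M : Type) : M -> lmodType R := fun _ => R^o.

Lemma dsum_lift_sum (I : choiceType) (V : I -> lmodType R) (P : lmodType R)
    (g : forall i, {linear V i -> P}) (x : dsum V) :
  exists A : {fset I}, dsum_lift g x = \sum_(i <- A) g i (x i).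
Proof.
have [A hA] := dsum_supp x; exists A; exact: dsum_lift_fset.
Qed.

Definition free_eval (M N : lmodType R) (w : M -> N) :
  {linear dsum (@free_mod M) -> N} := dsum_lift (fun m => scale_vec (w m)).

Lemma free_eval_inj (M N : lmodType R) (w : M -> N) m (a : R^o) :
  free_eval w (@dsum_inj R M (@free_mod M) m a) = (a : R) *: w m.
Proof. exact: (@dsum_lift_inj R M (@free_mod M) N (fun m => scale_vec (w m))). Qed.

(** Evaluation of formal combinations is onto, so the identity lifts through it. The section gives
    coordinates on $M$, in which membership in $IM$ can be tested. *)
Lemma projective_section (M : lmodType R) : projective M ->
  exists sigma : {linear M -> dsum (@free_mod M)},
    forall x, free_eval id (sigma x) = x.
Proof.
move=> /(_ _ M (free_eval id) idfun)[|sigma hs]; last by exists sigma.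
move=> b; exists (@dsum_inj R M (@free_mod M) b 1).
by rewrite free_eval_inj scale1r.
Qed.

(** Dividing $u(m)$ by $s$ modulo $I$ for each element $m$ separately gives a function [w] that may
    fail to be linear. Extending it linearly from the basis of the free module on $M$ and composing
    with the section [sigma] restores linearity. *)
Lemma projective_lift_mod (I : set R) (s : R) (M N : lmodType R)
    (u : {linear M -> N}) : projective M ->
  (forall x, idmul (ideal_adjoin I s) (u x)) ->
  exists v : {linear M -> N}, forall x, idmul I (u x - s *: v x).
Proof.
move=> /projective_section[sigma hs] hu.
have [w hw] := choice (fun m => idmul_adjoin (hu m)).
exists (free_eval w \o sigma) => x /=.
rewrite -{1}[x]hs; have [A hA] := dsum_supp (sigma x).
rewrite /free_eval /= !(dsum_lift_fset _ hA).
rewrite linear_sum scaler_sumr -sumrB.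
apply: idmul_sum => m; rewrite /= /scale_vec linearZ /= scalerA (mulrC s) -scalerA.
by rewrite -scalerBr; apply: idmul_scale.
Qed.

Section Projection.
Variables (I : choiceType) (V : I -> lmodType R) (i : I).
Definition dsum_proj (x : dsum V) : V i := x i.
Fact dsum_proj_linear : linear dsum_proj.
Proof. by []. Qed.
HB.instance Definition _ :=
  GRing.isLinear.Build R (dsum V) (V i) *:%R dsum_proj dsum_proj_linear.
End Projection.

(** Torsion-freeness of $M/pM$ away from $p$: each coordinate of $s\,\sigma(x)$ lies in $p$, so the
    primality of $p$ cancels $s$ coordinate by coordinate. *)
Lemma projective_saturated (p : Spec R) (s : R) (M : lmodType R) (x : M) :
  projective M -> ~ p s -> idmul p (s *: x) -> idmul p x.
Proof.
move=> /projective_section[sigma hs] ps psx; rewrite -[x]hs.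
have [A] := dsum_lift_sum (fun m => scale_vec m) (sigma x).
rewrite /free_eval /= => ->.
apply: idmul_sum => m; apply: idmulZ; have [pI _ pP] := Defs.primeP p.
have := idmul_lin sigma psx; rewrite linearZ /=.
move=> /(idmul_lin (@dsum_proj M (@free_mod M) m))/(idmul_scalar pI)/pP[|] //.
Qed.

Lemma projective_dsum (I : choiceType) (V : I -> lmodType R) :
  (forall i, projective (V i)) -> projective (dsum V).
Proof.
move=> hV A B g f hg.
have hi i : {h : {linear V i -> A} | forall x, g (h x) = f (@dsum_inj R I V i x)}.
  by apply: cid; apply: (hV i A B g (f \o @dsum_inj R I V i) hg).
exists (dsum_lift (fun i => sval (hi i))).
apply: (@dsum_ext R I V B (g \o _) f) => i v /=.
by rewrite dsum_lift_inj; apply: (svalP (hi i)).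
Qed.

Definition dual_basis (M : lmodType R) (n : nat) (v : 'I_n -> M)
  (c : 'I_n -> {linear M -> R^o}) := forall x, x = \sum_k (c k x : R) *: v k.

Section LinearCombination.
Variables (M : lmodType R) (n : nat) (v : 'I_n -> M).
Definition lincomb (a : 'rV[R]_n) : M := \sum_k a 0 k *: v k.
Fact lincomb_linear : linear lincomb.
Proof.
move=> a x y; rewrite /lincomb scaler_sumr -big_split /=.
by apply: eq_bigr => k _; rewrite !mxE scalerDl scalerA.
Qed.
HB.instance Definition _ :=
  GRing.isLinear.Build R 'rV[R]_n M *:%R lincomb lincomb_linear.
End LinearCombination.

Section Coordinate.
Variables (n : nat) (k : 'I_n).
Definition row_coord (a : 'rV[R]_n) : R^o := a 0 k.
Fact row_coord_linear : linear row_coord.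
Proof. by move=> a x y; rewrite /row_coord !mxE. Qed.
HB.instance Definition _ :=
  GRing.isLinear.Build R 'rV[R]_n R^o *:%R row_coord row_coord_linear.
End Coordinate.

Lemma fg_projective_dual_basis (M : lmodType R) : fin_gen M -> projective M ->
  exists n (v : 'I_n -> M) (c : 'I_n -> {linear M -> R^o}), dual_basis v c.
Proof.
move=> [n [v hv]] /(_ _ M (lincomb v) idfun)[|h hh].
  move=> b; have [c ->] := hv b; exists (\row_k c k).
  by apply: eq_bigr => k _; rewrite mxE.
exists n, v, (fun k => row_coord k \o h) => x; exact/esym/hh.
Qed.

Section PureLeft.
Variables (M N : lmodType R) (m : M).
Definition pure_left : N -> tens M N := pure m.
HB.instance Definition _ :=
  GRing.isLinear.Build R N (tens M N) *:%R pure_left (@pure_linr R M N m).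
End PureLeft.

Section DualBilinear.
Variables (M N P : lmodType R) (n : nat).
Variables (c : 'I_n -> {linear M -> R^o}) (h : 'I_n -> {linear N -> P}).
Definition dual_bilin_fun (x : M) (y : N) : P := \sum_k (c k x : R) *: h k y.
Fact dual_bilin_linl y : linear (dual_bilin_fun^~ y).
Proof.
move=> a u v; rewrite /dual_bilin_fun scaler_sumr -big_split /=.
by apply: eq_bigr => k _; rewrite linearP scalerDl scalerA.
Qed.
Fact dual_bilin_linr x : linear (dual_bilin_fun x).
Proof.
move=> a u v; rewrite /dual_bilin_fun scaler_sumr -big_split /=.
by apply: eq_bigr => k _; rewrite linearP scalerDr !scalerA mulrC.
Qed.
Definition dual_bilin := MkBilin dual_bilin_linl dual_bilin_linr.
End DualBilinear.

(** For each member $v_k$ of a finite dual basis of $M$, the map $f(v_k \otimes -)$ lifts to some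
    $h_k$ on $N$; the lift of $f$ is then $x \otimes y \mapsto \sum_k c_k(x) h_k(y)$. *)
Lemma projective_tens (M N : lmodType R) :
  fin_gen M -> projective M -> projective N -> projective (tens M N).
Proof.
move=> gM pM pN A B g f hg.
have [n [v [c vc]]] := fg_projective_dual_basis gM pM.
have [h hh] := choice (fun k => pN A B g (f \o @pure_left M N (v k)) hg).
exists (tens_lift (dual_bilin c h)).
apply: (@tens_ext R M N B (g \o _) f) => x y /=.
rewrite tens_liftE /= /dual_bilin_fun linear_sum [in RHS](vc x).
transitivity (\sum_k (c k x : R) *: f (pure (v k) y)).
  by apply: eq_bigr => k _; rewrite linearZ hh.
have -> : pure (\sum_k (c k x : R) *: v k) y = \sum_k (c k x : R) *: pure (v k) y.
  elim/big_rec2: _ => [|k u w _ <-]; first by rewrite pure0l.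
  by rewrite pureDl pureZl.
by rewrite linear_sum; apply: eq_bigr => k _; rewrite linearZ.
Qed.

End Projective.

(** * Generators and universal property of the tensor complex *)

Section TensorGenerators.
Variables (R : comPzRingType) (X Y : complex R).

Section Bilinear.
Variables (n i j : int) (e : i + j == n).

Lemma tgenDl (x x' : X i) (y : Y j) : tgen e (x + x') y = tgen e x y + tgen e x' y.
Proof. by rewrite /tgen pureDl linearD. Qed.
Lemma tgenDr (x : X i) (y y' : Y j) : tgen e x (y + y') = tgen e x y + tgen e x y'.
Proof. by rewrite /tgen pureDr linearD. Qed.
Lemma tgenZl a (x : X i) (y : Y j) : tgen e (a *: x) y = a *: tgen e x y.
Proof. by rewrite /tgen pureZl linearZ. Qed.
Lemma tgenZr a (x : X i) (y : Y j) : tgen e x (a *: y) = a *: tgen e x y.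
Proof. by rewrite /tgen pureZr linearZ. Qed.
Lemma tgenNl (x : X i) (y : Y j) : tgen e (- x) y = - tgen e x y.
Proof. by rewrite -scaleN1r tgenZl scaleN1r. Qed.
Lemma tgenNr (x : X i) (y : Y j) : tgen e x (- y) = - tgen e x y.
Proof. by rewrite -scaleN1r tgenZr scaleN1r. Qed.

Section Compose.
Variables (M N : lmodType R) (u : {linear M -> X i}) (v : {linear N -> Y j}).
Definition tgen_fun (x : M) (y : N) : tob X Y n := tgen e (u x) (v y).
Fact tgen_linl y : linear (tgen_fun^~ y).
Proof. by move=> a x x'; rewrite /tgen_fun linearP tgenDl tgenZl. Qed.
Fact tgen_linr x : linear (tgen_fun x).
Proof. by move=> a y y'; rewrite /tgen_fun linearP tgenDr tgenZr. Qed.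
Definition tgen_bilin := MkBilin tgen_linl tgen_linr.
End Compose.

Lemma idmul_tgen (I J K : set R) (x : X i) (y : Y j) :
  (forall a b, I a -> J b -> K (a * b)) ->
  idmul I x -> idmul J y -> idmul K (tgen e x y).
Proof.
by move=> IJK Ix Jy; rewrite /tgen; apply: idmul_lin; apply: idmul_pure IJK Ix Jy.
Qed.

Lemma idmul_tgenl (I : set R) (x : X i) (y : Y j) :
  idmul I x -> idmul I (tgen e x y).
Proof. by move=> Ix; rewrite /tgen; apply: idmul_lin; apply: idmul_purel. Qed.

Lemma idmul_tgenr (I : set R) (x : X i) (y : Y j) :
  idmul I y -> idmul I (tgen e x y).
Proof. by move=> Ix; rewrite /tgen; apply: idmul_lin; apply: idmul_purer. Qed.

End Bilinear.

Section Lift.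
Variables (n : int) (P : lmodType R).
Variable b : forall i j : int, i + j == n -> bilin (X i) (Y j) P.

Definition tob_lift : tob X Y n -> P :=
  dsum_lift (fun p : bideg n => tens_lift (b (proj2_sig p))).
HB.instance Definition _ := GRing.Linear.on tob_lift.

Lemma tob_liftE (i j : int) (e : i + j == n) (x : X i) (y : Y j) :
  tob_lift (tgen e x y) = b e x y.
Proof. by rewrite /tob_lift /= dsum_lift_inj /= tens_liftE. Qed.

End Lift.

Lemma tob_ind n (P : tob X Y n -> Prop) :
  P 0 -> (forall z w, P z -> P w -> P (z + w)) ->
  (forall (i j : int) (e : i + j == n) x y, P (tgen e x y)) -> forall z, P z.
Proof.
move=> P0 PD Pg z; have [A /dsum_sum ->] := dsum_supp z.
apply: big_ind => // -[[i j] e] _ /=.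
rewrite [z _]tens_sum linear_sum; apply: big_ind => // -[x y] _.
exact: Pg.
Qed.

(* Every degree is a successor. *)
Lemma tob_ind_succ n (P : tob X Y n -> Prop) :
  P 0 -> (forall z w, P z -> P w -> P (z + w)) ->
  (forall (i j : int) (e : i + 1 + (j + 1) == n) x y, P (tgen e x y)) -> forall z, P z.
Proof.
move=> P0 PD Pg; apply: tob_ind => // i j.
have -> : i = i - 1 + 1 by rewrite subrK.
have -> : j = j - 1 + 1 by rewrite subrK.
exact: Pg.
Qed.

Lemma tob_projective n : (forall i, fin_gen (X i)) ->
  (forall i, projective (X i)) -> (forall i, projective (Y i)) ->
  projective (tob X Y n).
Proof. by move=> gX pX pY; apply: projective_dsum => p; apply: projective_tens. Qed.

End TensorGenerators.

(** * Signs of degrees *)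

Section Sign.
Variable R : comPzRingType.

(** The absolute value is not additive, but its parity is. *)
Lemma sign_add (i j : int) :
  (-1) ^+ absz (i + j) = (-1) ^+ absz i * (-1) ^+ absz j :> R.
Proof.
rewrite -exprD -[LHS]signr_odd -[RHS]signr_odd; congr (_ ^+ _).
lia.
Qed.

Lemma sign_sqr (i : int) : (-1) ^+ absz i * (-1) ^+ absz i = 1 :> R.
Proof. by rewrite -exprD addnn -mul2n exprM sqrrN expr1n expr1n. Qed.
End Sign.

(** * Associativity of the tensor product of complexes *)

Section Associativity.
Variables (R : comPzRingType) (X Y Z : complex R).

Section ToLeft.
Variable n : int.

Section Inner.
Variables (i m : int) (e : i + m == n) (x : X i).
Fact assocl_degl (j k : int) (d : j + k == m) : i + j + k == n.
Proof. by rewrite -addrA (eqP d) e. Qed.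

Section XLinear.
Variable j : int.
Definition tgen_left (y : Y j) : tob X Y (i + j) := tgen (eqxx (i + j)) x y.
Fact tgen_left_linear : linear tgen_left.
Proof. by move=> a y y'; rewrite /tgen_left tgenDr tgenZr. Qed.
HB.instance Definition _ := GRing.isLinear.Build R (Y j) (tob X Y (i + j)) *:%R
  tgen_left tgen_left_linear.
End XLinear.

(** The associator with its first argument $x$ fixed; a second lift, bilinear in $x$ and the inner
    tensor, then removes this restriction. *)
Definition assocl_inner : tob Y Z m -> tob (tcomplex X Y) Z n :=
  tob_lift (fun j k d => @tgen_bilin R (tcomplex X Y) Z n _ _ (assocl_degl d)
    _ _ (@tgen_left j) idfun).
HB.instance Definition _ := GRing.Linear.on assocl_inner.

Lemma assocl_innerE (j k : int) (d : j + k == m) (y : Y j) (z : Z k) :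
  assocl_inner (tgen d y z) =
  @tgen R (tcomplex X Y) Z n _ _ (assocl_degl d) (tgen (eqxx (i + j)) x y) z.
Proof. exact: tob_liftE. Qed.
End Inner.

Fact assocl_inner_linl (i m : int) (e : i + m == n) w :
  linear (fun x : X i => assocl_inner e x w).
Proof.
move=> a x x'.
elim/tob_ind: w => [|w w' IH IH'|j k d y z].
- by rewrite /= !linear0 addr0.
- by rewrite /= !linearD /= IH IH' addrACA.
rewrite !assocl_innerE.
by rewrite tgenDl tgenZl tgenDl tgenZl.
Qed.

Definition assocl : tob X (tcomplex Y Z) n -> tob (tcomplex X Y) Z n :=
  @tob_lift R X (tcomplex Y Z) n _ (fun i m e =>
    @MkBilin R (X i) (tob Y Z m) _ _
      (assocl_inner_linl e) (fun x => linearP (assocl_inner e x))).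
HB.instance Definition _ := GRing.Linear.on assocl.

(** The inner degrees $m$ and $l$ are variables tied down by equations, because the sums of degrees
    met in computations agree only propositionally. Substituting $l$ returns to the degree $i + j$
    used in the construction. *)
Lemma assoclE (i j k m l : int) (e : i + m == n) (d : j + k == m) (e' : l + k == n)
    (d' : i + j == l) (x : X i) (y : Y j) (z : Z k) :
  assocl (@tgen R X (tcomplex Y Z) n i m e x (tgen d y z)) =
  @tgen R (tcomplex X Y) Z n l k e' (tgen d' x y) z.
Proof.
rewrite /assocl (@tob_liftE R X (tcomplex Y Z)) /= assocl_innerE.
have El := eqP d'; subst l.
by rewrite (bool_irrelevance d' (eqxx _)); exact: tgen_irr.
Qed.

End ToLeft.

Section ToRight.
Variable n : int.

Section Inner.
Variables (l k : int) (e : l + k == n) (z : Z k).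
Fact assocr_degr (i j : int) (d : i + j == l) : i + (j + k) == n.
Proof. by rewrite addrA (eqP d) e. Qed.

Section YLinear.
Variable j : int.
Definition tgen_right (y : Y j) : tob Y Z (j + k) := tgen (eqxx (j + k)) y z.
Fact tgen_right_linear : linear tgen_right.
Proof. by move=> a y y'; rewrite /tgen_right tgenDl tgenZl. Qed.
HB.instance Definition _ := GRing.isLinear.Build R (Y j) (tob Y Z (j + k)) *:%R
  tgen_right tgen_right_linear.
End YLinear.

Definition assocr_inner : tob X Y l -> tob X (tcomplex Y Z) n :=
  tob_lift (fun i j d => @tgen_bilin R X (tcomplex Y Z) n _ _ (assocr_degr d)
    _ _ idfun (@tgen_right j)).
HB.instance Definition _ := GRing.Linear.on assocr_inner.

Lemma assocr_innerE (i j : int) (d : i + j == l) (x : X i) (y : Y j) :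
  assocr_inner (tgen d x y) =
  @tgen R X (tcomplex Y Z) n _ _ (assocr_degr d) x (tgen (eqxx (j + k)) y z).
Proof. exact: tob_liftE. Qed.
End Inner.

Fact assocr_inner_linr (l k : int) (e : l + k == n) w :
  linear (fun z : Z k => assocr_inner e z w).
Proof.
move=> a z z'.
elim/tob_ind: w => [|w w' IH IH'|i j d x y].
- by rewrite /= !linear0 addr0.
- by rewrite /= !linearD /= IH IH' addrACA.
rewrite !assocr_innerE.
by rewrite tgenDr tgenZr tgenDr tgenZr.
Qed.

Definition assocr : tob (tcomplex X Y) Z n -> tob X (tcomplex Y Z) n :=
  @tob_lift R (tcomplex X Y) Z n _ (fun l k e =>
    @MkBilin R (tob X Y l) (Z k) _
      (fun w z => assocr_inner e z w)
      (fun z => linearP (assocr_inner e z)) (assocr_inner_linr e)).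
HB.instance Definition _ := GRing.Linear.on assocr.

Lemma assocrE (i j k m l : int) (e : i + m == n) (d : j + k == m) (e' : l + k == n)
    (d' : i + j == l) (x : X i) (y : Y j) (z : Z k) :
  assocr (@tgen R (tcomplex X Y) Z n l k e' (tgen d' x y) z) =
  @tgen R X (tcomplex Y Z) n i m e x (tgen d y z).
Proof.
rewrite /assocr (@tob_liftE R (tcomplex X Y) Z) /= assocr_innerE.
have Em := eqP d; subst m.
by rewrite (bool_irrelevance d (eqxx _)); exact: tgen_irr.
Qed.

End ToRight.

Lemma tob3_ext n (P : lmodType R) (f g : {linear tob X (tcomplex Y Z) n -> P}) :
  (forall (i j k m : int) (e : i + m == n) (d : j + k == m) x y z,
    f (@tgen R X (tcomplex Y Z) n i m e x (tgen d y z)) =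
    g (@tgen R X (tcomplex Y Z) n i m e x (tgen d y z))) -> f =1 g.
Proof.
move=> h; apply: (@tgen_ext R X (tcomplex Y Z)) => i m e x w.
elim/tob_ind: w => [|w w' IH IH'|j k d y z]; last exact: h.
  by rewrite tgen0r !linear0.
by rewrite tgenDr !linearD /= IH IH'.
Qed.

Lemma tob3_extl n (P : lmodType R) (f g : {linear tob (tcomplex X Y) Z n -> P}) :
  (forall (i j k l : int) (e : l + k == n) (d : i + j == l) x y z,
    f (@tgen R (tcomplex X Y) Z n l k e (tgen d x y) z) =
    g (@tgen R (tcomplex X Y) Z n l k e (tgen d x y) z)) -> f =1 g.
Proof.
move=> h; apply: (@tgen_ext R (tcomplex X Y) Z) => l k e w z.
elim/tob_ind: w => [|w w' IH IH'|i j d x y]; last exact: h.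
  by rewrite tgen0l !linear0.
by rewrite tgenDl !linearD /= IH IH'.
Qed.

Lemma assoclK n w : assocr (@assocl n w) = w.
Proof.
apply: (@tob3_ext n _ (@assocr n \o @assocl n) idfun) => i j k m e d x y z /=.
have e' : i + j + k == n by rewrite -addrA (eqP d) e.
by rewrite (assoclE e d e' (eqxx _)) (assocrE e d).
Qed.

(** The associator carries no sign: on the term with $dz$, the nested signs $(-1)^i$ and $(-1)^j$ on
    one side multiply to the sign $(-1)^{i+j}$ on the other. *)
Fact assocl_comm n (w : tcomplex X (tcomplex Y Z) n) :
  assocl (diff _ n w) = diff (tcomplex (tcomplex X Y) Z) n (assocl w).
Proof.
apply: (@tob3_ext n _ (@assocl (n + 1) \o tdiff X (tcomplex Y Z) n)
   (tdiff (tcomplex X Y) Z n \o @assocl n)) => i j k m e d x y z /=.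
have En := eqP e; have Em := eqP d; subst m; subst n.
have e' : i + j + k == i + (j + k) by rewrite addrA.
rewrite (assoclE e d e' (eqxx _)).
have e1 : i + 1 + (j + k) == i + (j + k) + 1 by rewrite addrAC.
have e2 : i + (j + k + 1) == i + (j + k) + 1 by rewrite addrA.
have d1 : j + 1 + k == j + k + 1 by rewrite addrAC.
have d2 : j + (k + 1) == j + k + 1 by rewrite addrA.
have e1' : i + j + 1 + k == i + (j + k) + 1 by rewrite addrAC addrA.
have e2' : i + j + (k + 1) == i + (j + k) + 1 by rewrite !addrA.
have d1' : i + 1 + j == i + j + 1 by rewrite addrAC.
have d2' : i + (j + 1) == i + j + 1 by rewrite addrA.
rewrite (@tdiff_gen R X (tcomplex Y Z) _ _ _ e e1 e2) /=.
rewrite (@tdiff_gen R (tcomplex X Y) Z _ _ _ e' e1' e2') /=.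
rewrite (tdiff_gen _ d1 d2) (tdiff_gen _ d1' d2').
rewrite (tgenDr (Y := tcomplex Y Z)) (tgenZr (Y := tcomplex Y Z)).
rewrite (tgenDl (X := tcomplex X Y)) (tgenZl (X := tcomplex X Y)).
rewrite scalerDr scalerA -sign_add !linearD !linearZ /=.
rewrite (assoclE e1 d e1' d1') (assoclE e2 d1 e1' d2') (assoclE e2 d2 e2' (eqxx _)).
exact: addrA.
Qed.

Lemma assocrK n w : assocl (@assocr n w) = w.
Proof.
apply: (@tob3_extl n _ (@assocl n \o @assocr n) idfun) => i j k l e' d' x y z /=.
have e : i + (j + k) == n by rewrite addrA (eqP d') e'.
by rewrite (assocrE e (eqxx _)) (assoclE _ _ e' d').
Qed.

Definition assocl_map :
  chain_map (tcomplex X (tcomplex Y Z)) (tcomplex (tcomplex X Y) Z) :=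
  @MkChainMap R (tcomplex X (tcomplex Y Z)) (tcomplex (tcomplex X Y) Z)
    assocl assocl_comm.

Fact assocr_comm n (w : tcomplex (tcomplex X Y) Z n) :
  assocr (diff _ n w) = diff (tcomplex X (tcomplex Y Z)) n (assocr w).
Proof. by rewrite -{1}[w]assocrK -assocl_comm assoclK. Qed.

Definition assocr_map :
  chain_map (tcomplex (tcomplex X Y) Z) (tcomplex X (tcomplex Y Z)) :=
  @MkChainMap R (tcomplex (tcomplex X Y) Z) (tcomplex X (tcomplex Y Z))
    assocr assocr_comm.

End Associativity.

Lemma assocl_natural (R : comPzRingType) (X X' Y Y' Z Z' : complex R)
    (f : chain_map X X') (g : chain_map Y Y') (h : chain_map Z Z') n w :
  assocl_map X' Y' Z' n (tcmap f (tcmap g h) n w) =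
  tcmap (tcmap f g) h n (assocl_map X Y Z n w).
Proof.
apply: (@tob3_ext R X Y Z n _ (@assocl R X' Y' Z' n \o tcmap_fun f (tcmap g h) n)
  (tcmap_fun (tcmap f g) h n \o @assocl R X Y Z n)) => i j k m e d x y z /=.
have e' : i + j + k == n by rewrite -addrA (eqP d) e.
rewrite (@tcmap_gen R X X' (tcomplex Y Z) (tcomplex Y' Z')) /= tcmap_gen.
rewrite !(assoclE e d e' (eqxx _)).
by rewrite (@tcmap_gen R (tcomplex X Y) (tcomplex X' Y')) /= tcmap_gen.
Qed.

(** * Families indexed by successor degrees *)

Section Reindex.

Section EveryInt.
Variables (T : int -> Type) (u : forall i : int, T (i + 1)).
(** Homotopy formulas are stated in degrees $i + 1$ only; this transports such a family to all
    degrees, and [every_intS] removes the transport at a successor. *)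
Definition every_int (i : int) : T i := ecast k (T k) (subrK 1 i) (u (i - 1)).
Lemma every_intS i : every_int (i + 1) = u i.
Proof.
rewrite /every_int; move: (subrK _ _); rewrite (addrK 1 i) => e.
by rewrite (eq_irrelevance e erefl).
Qed.
End EveryInt.

Variables (R : comPzRingType) (A B : complex R).
Variable h : forall i, {linear A (i + 1) -> B i}.

(** A homotopy read off at a source degree that is not syntactically a successor. *)
Definition homotopy_at (i k : int) (e : k + 1 = i) : {linear A i -> B k} :=
  ecast m ({linear A m -> B k}) e (h k).

Lemma homotopy_atE i (e : i + 1 = i + 1) : homotopy_at e = h i.
Proof. by rewrite (eq_irrelevance e erefl). Qed.

End Reindex.

(** * Homotopies on tensor products *)

Section TensorHomotopy.
Variables (R : comPzRingType) (A A' B B' : complex R).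

Section Left.
Variable h : forall i, {linear A (i + 1) -> B i}.
Variable g : forall j, {linear A' j -> B' j}.

Fact htensl_deg n (i j : int) : i + j == n + 1 -> i - 1 + j == n.
Proof. by move=> /eqP e; rewrite addrAC e addrK. Qed.

Definition htensl n : tob A A' (n + 1) -> tob B B' n :=
  tob_lift (fun i j e => tgen_bilin (htensl_deg e)
    (homotopy_at h (subrK 1 i)) (g j)).
HB.instance Definition _ n := GRing.Linear.on (@htensl n).

Lemma htenslE n (i j : int) (e : i + 1 + j == n + 1) (e' : i + j == n)
    (x : A (i + 1)) (y : A' j) :
  htensl (tgen e x y) = tgen e' (h i x) (g j y).
Proof.
rewrite /htensl tob_liftE /= /tgen_fun; move: (htensl_deg _) (subrK _ _).
by rewrite (addrK 1 _) => e1 e2; rewrite homotopy_atE (bool_irrelevance e1 e').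
Qed.

(** Here [g] is any family of linear maps; the last term measures its failure to commute with the
    differentials. It is kept because [g] will also be a family that is a chain map only modulo an
    ideal. *)
Lemma htensl_boundary n (i j : int) (e : i + 1 + j == n + 1)
    (e' : i + (j + 1) == n + 1) (x : A (i + 1)) (y : A' j) :
  tdiff B B' n (htensl (tgen e x y)) + htensl (tdiff A A' (n + 1) (tgen e x y)) =
  tgen e (diff B i (h i x) + h (i + 1) (diff A (i + 1) x)) (g j y) +
  (-1) ^+ absz i *:
    tgen e' (h i x) (diff B' j (g j y) - g (j + 1) (diff A' j y)).
Proof.
have e0 : i + j == n by rewrite -(inj_eq (addIr 1)) addrAC.
have el : i + 1 + 1 + j == n + 1 + 1 by rewrite addrAC (eqP e).
have er : i + 1 + (j + 1) == n + 1 + 1 by rewrite addrA (eqP e).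
rewrite (htenslE e e0) (tdiff_gen e0 e e') (tdiff_gen e el er).
rewrite linearD linearZ /= (htenslE el e) (htenslE er e') sign_succ.
by rewrite tgenDl tgenDr tgenNr scalerDr scalerN scaleNr addrACA.
Qed.

End Left.

Section Right.
Variable g : forall i, {linear A i -> B i}.
Variable k : forall j, {linear A' (j + 1) -> B' j}.

Fact htensr_deg n (i j : int) : i + j == n + 1 -> i + (j - 1) == n.
Proof. by move=> /eqP e; rewrite addrA e addrK. Qed.

(** The sign $(-1)^i$ is the Koszul sign for moving the degree $-1$ map [k] past $x$. *)
Definition htensr n : tob A A' (n + 1) -> tob B B' n :=
  tob_lift (fun i j e => tgen_bilin (htensr_deg e)
    ((-1) ^+ absz i \*: g i) (homotopy_at k (subrK 1 j))).
HB.instance Definition _ n := GRing.Linear.on (@htensr n).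

Lemma htensrE n (i j : int) (e : i + (j + 1) == n + 1) (e' : i + j == n)
    (x : A i) (y : A' (j + 1)) :
  htensr (tgen e x y) = (-1) ^+ absz i *: tgen e' (g i x) (k j y).
Proof.
rewrite /htensr tob_liftE /= /tgen_fun; move: (htensr_deg _) (subrK _ _).
by rewrite (addrK 1 _) => e1 e2; rewrite homotopy_atE (bool_irrelevance e1 e') tgenZl.
Qed.

Lemma htensr_boundary n (i j : int) (e : i + (j + 1) == n + 1)
    (e' : i + 1 + j == n + 1) (x : A i) (y : A' (j + 1)) :
  tdiff B B' n (htensr (tgen e x y)) + htensr (tdiff A A' (n + 1) (tgen e x y)) =
  tgen e (g i x) (diff B' j (k j y) + k (j + 1) (diff A' (j + 1) y)) +
  (-1) ^+ absz i *:
    tgen e' (diff B i (g i x) - g (i + 1) (diff A i x)) (k j y).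
Proof.
have e0 : i + j == n by rewrite -(inj_eq (addIr 1)) addrAC.
have el : i + 1 + (j + 1) == n + 1 + 1 by rewrite addrAC (eqP e).
have er : i + (j + 1 + 1) == n + 1 + 1 by rewrite addrA (eqP e).
rewrite (tdiff_gen e el er) linearD linearZ /= (htensrE el e') (htensrE er e).
rewrite (htensrE e e0) linearZ /= (tdiff_gen e0 e' e) sign_succ.
rewrite scalerDr !scalerA sign_sqr !scale1r.
rewrite tgenDl tgenDr tgenNl scalerDr scalerN scaleNr.
rewrite addrACA; exact: addrC.
Qed.

End Right.

End TensorHomotopy.

(** * Nullity modulo an ideal *)

Section NullModuloIdeal.
Variable R : comPzRingType.

Section Defect.
Variables (C D : complex R) (phi : chain_map C D).
Variable h : forall i, {linear C (i + 1) -> D i}.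

Definition boundary i : {linear C (i + 1) -> D (i + 1)} :=
  (diff D i \o h i) \+ (h (i + 1) \o diff C (i + 1)).

(** The representative $\phi - dh - hd$ of the homotopy class of $\phi$, extended to every degree so
    that it can be a factor in [htensr]. *)
Definition defect : forall i, {linear C i -> D i} :=
  every_int (fun i => phi (i + 1) \- boundary i : {linear C (i + 1) -> D (i + 1)}).

Lemma defectE i x : defect (i + 1) x = phi (i + 1) x - boundary i x.
Proof. by rewrite /defect every_intS. Qed.

(** Since $d^2 = 0$, both $d(dh + hd)$ and $(dh + hd)d$ equal $dhd$. *)
Lemma defect_comm i (x : C i) : diff D i (defect i x) = defect (i + 1) (diff C i x).
Proof.
move: x; have <- : i - 1 + 1 = i by rewrite subrK.
move: (i - 1) => {}i x.
rewrite !defectE linearB /= chain_comm linearD /= !diffK linear0 add0r addr0.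
by [].
Qed.

End Defect.

(** Stated for families of linear maps, so that it applies to $s f$ without building a chain map. *)
Definition null_mod (I : set R) (C D : complex R)
    (u : forall i, {linear C i -> D i}) : Prop :=
  exists h : forall i, {linear C (i + 1) -> D i},
    forall i (x : C (i + 1)), idmul I (u (i + 1) x - boundary h i x).

Lemma null_mod_tob (K : set R) (A B C D : complex R) (phi : chain_map A B)
    (psi : chain_map C D)
    (H : forall n, {linear tob A C (n + 1) -> tob B D n}) :
  (forall n (i j : int) (e : i + 1 + (j + 1) == n + 1) x y,
    idmul K (tgen e (phi (i + 1) x) (psi (j + 1) y) -
      @boundary (tcomplex A C) (tcomplex B D) H n (tgen e x y))) ->
  null_mod K (tcmap phi psi).
Proof.
move=> hH; exists H => n.
pose F : {linear tob A C (n + 1) -> tob B D (n + 1)} :=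
  tcmap_fun phi psi (n + 1) \- @boundary (tcomplex A C) (tcomplex B D) H n.
apply: (@tob_ind_succ R A C (n + 1) (fun z => idmul K (F z))).
- by rewrite linear0; apply: idmul0.
- by move=> z w Fz Fw; rewrite linearD; apply: idmulD.
by move=> i j e x y; rewrite /F /= tcmap_gen; apply: hH.
Qed.

Lemma boundary_tob (A B C D : complex R)
    (H H' : forall n, {linear tob A C (n + 1) -> tob B D n}) n z :
  @boundary (tcomplex A C) (tcomplex B D) (fun n => H n \+ H' n) n z =
  (tdiff B D n (H n z) + H (n + 1) (tdiff A C (n + 1) z)) +
  (tdiff B D n (H' n z) + H' (n + 1) (tdiff A C (n + 1) z)).
Proof. by rewrite addrACA -linearD. Qed.

(** With $g$ the defect of $\phi$, the homotopy $h \otimes \psi + g \otimes k$ deforms $\phi \otimes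
    \psi$ first to $g \otimes \psi$, then to the tensor product of the two defects, whose values
    carry a factor from $I$ and one from $J$. *)
Lemma null_mod_tens (I J K : set R) (A B C D : complex R) (phi : chain_map A B)
    (psi : chain_map C D) : (forall a b, I a -> J b -> K (a * b)) ->
  null_mod I phi -> null_mod J psi -> null_mod K (tcmap phi psi).
Proof.
move=> IJK [h hI] [k kJ]; pose g := defect phi h.
pose H n : {linear tob A C (n + 1) -> tob B D n} :=
  @htensl R _ _ _ _ h psi n \+ @htensr R _ _ _ _ g k n.
apply: (null_mod_tob (H := H)) => n i j e x y.
have el : i + 1 + 1 + j == n + 1 by rewrite -(eqP e) -!addrA (addrC 1 j).
have er : i + (j + 1 + 1) == n + 1 by rewrite -(eqP e) -!addrA (addrCA j 1).
have -> : @boundary (tcomplex A C) (tcomplex B D) H n (tgen e x y) =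
  tgen e (boundary h i x) (psi (j + 1) y) +
  tgen e (g (i + 1) x) (boundary k j y).
  rewrite boundary_tob (htensl_boundary _ _ e er) (htensr_boundary _ _ e el).
  by rewrite chain_comm defect_comm !subrr tgen0r tgen0l !scaler0 !addr0.
rewrite opprD addrA -tgenNl -tgenDl -defectE -/g -tgenNr -tgenDr.
by apply: (idmul_tgen _ IJK); [rewrite defectE; apply: hI|apply: kJ].
Qed.

(* Modulo p the defect of the homotopy for phi is [s] times a chain map [g],
   because the target is s-torsion free modulo p, and tensoring [g] with [s f]
   gives a null-homotopic map. *)
Lemma null_mod_prime_step (p : Spec R) (s : R) (X Y C D : complex R)
    (f : chain_map X Y) (phi : chain_map C D) :
  ~ p s -> (forall i, projective (C i)) -> (forall i, projective (D i)) ->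
  null_mod p (fun i => s \*: f i) -> null_mod (ideal_adjoin p s) phi ->
  null_mod p (tcmap f phi).
Proof.
move=> ps prC prD [k hk] [h hh].
have hg i : {g : {linear C (i + 1) -> D (i + 1)} |
    forall x, idmul p (defect phi h (i + 1) x - s *: g x)}.
  apply: cid; apply: projective_lift_mod => // x.
  by rewrite defectE; apply: hh.
pose g := @every_int (fun i => {linear C i -> D i}) (fun i => sval (hg i)).
have gP i x : idmul p (defect phi h i x - s *: g i x).
  move: x; have <- : i - 1 + 1 = i by rewrite subrK.
  by move=> x; rewrite /g every_intS; apply: (svalP (hg _)).
(* The defect commutes exactly with the differentials, so $s$ times this difference lies in $pD$;
   saturation cancels $s$. *)
have g_comm i x : idmul p (diff D i (g i x) - g (i + 1) (diff C i x)).
  apply: (projective_saturated (prD _) ps).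
  have := idmulB (gP (i + 1) (diff C i x)) (idmul_lin (diff D i) (gP i x)).
  have subBB (V : zmodType) (a b c : V) : a - b - (a - c) = c - b.
    by rewrite opprB addrC addrA subrK.
  rewrite [diff D i (_ - _)]linearB defect_comm subBB.
  by rewrite [diff D i (s *: _)]linearZ -scalerBr.
(* The summand $f \otimes h$ replaces $\phi$ by its defect, which is $s g$ modulo $p$; the summand
   $k \otimes g$ then contracts $(s f) \otimes g$ modulo $p$. *)
pose H n : {linear tob X C (n + 1) -> tob Y D n} :=
  @htensr R _ _ _ _ f h n \+ @htensl R _ _ _ _ k g n.
apply: (null_mod_tob (H := H)) => n i j e x y.
have el : i + 1 + 1 + j == n + 1 by rewrite -(eqP e) -!addrA (addrC 1 j).
have er : i + (j + 1 + 1) == n + 1 by rewrite -(eqP e) -!addrA (addrCA j 1).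
have -> : @boundary (tcomplex X C) (tcomplex Y D) H n (tgen e x y) =
  tgen e (f (i + 1) x) (boundary h j y) +
  (tgen e (boundary k i x) (g (j + 1) y) +
   (-1) ^+ absz i *: tgen er (k i x)
     (diff D (j + 1) (g (j + 1) y) - g (j + 1 + 1) (diff C (j + 1) y))).
  rewrite boundary_tob (htensr_boundary _ _ e el) (htensl_boundary _ _ e er).
  by rewrite chain_comm !subrr tgen0l !scaler0 !addr0.
rewrite opprD addrA -tgenNr -tgenDr -defectE.
(* Moving $s$ across the tensor sign leaves three terms in $p$: $f \otimes (\mathrm{defect} - s g)$,
   $(s f - dk - kd) \otimes g$, and the error from [g] being a chain map only modulo $p$. *)
rewrite -[defect _ _ _ _](subrK (s *: g (j + 1) y)) tgenDr tgenZr -tgenZl.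
rewrite opprD addrA -[X in X - _]addrA -tgenNl -tgenDl.
apply: idmulB; last by apply: idmul_scale; apply: idmul_tgenr; apply: g_comm.
by apply: idmulD; [apply: idmul_tgenr; apply: gP|apply: idmul_tgenl; apply: hk].
Qed.

(** The homotopy is carried along as $b h a$, because $a$ and $b$ commute with the differentials. *)
Lemma null_mod_retract (I : set R) (C D C' D' : complex R)
    (u : forall i, {linear C i -> D i}) (v : forall i, {linear C' i -> D' i})
    (a : chain_map C C') (b : chain_map D' D) :
  (forall i x, u i x = b i (v i (a i x))) -> null_mod I v -> null_mod I u.
Proof.
move=> uE [h hh]; exists (fun i => b i \o h i \o a (i + 1)) => i x.
rewrite /boundary /= uE (chain_comm a) -(chain_comm b) -linearD -linearB.
by apply: idmul_lin; apply: hh.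
Qed.

End NullModuloIdeal.

(** * Splitting tensor powers *)

Section TensorPowers.
Variable R : comPzRingType.

Section Composition.
Variables (X Y Z : complex R) (g : chain_map Y Z) (f : chain_map X Y).
Definition comp_fun i : {linear X i -> Z i} := g i \o f i.
Fact comp_comm i (x : X i) : comp_fun (i + 1) (diff X i x) = diff Z i (comp_fun i x).
Proof. by rewrite /= !chain_comm. Qed.
Definition comp_map := MkChainMap comp_comm.
End Composition.

Lemma tcmap_comp (A B C A' B' C' : complex R) (f : chain_map A B) (g : chain_map B C)
    (gf : chain_map A C) (f' : chain_map A' B') (g' : chain_map B' C')
    (gf' : chain_map A' C') :
  (forall i x, gf i x = g i (f i x)) -> (forall i x, gf' i x = g' i (f' i x)) ->
  forall n z, tcmap gf gf' n z = tcmap g g' n (tcmap f f' n z).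
Proof.
move=> E E' n; apply: (@tgen_ext R A A' n _ (tcmap_fun gf gf' n)
  (tcmap_fun g g' n \o tcmap_fun f f' n)) => i j e x y /=.
by rewrite !tcmap_gen E E'.
Qed.

(** Powers nest to the right, so splitting off the first $t + 1$ factors iterates the associator.
    Only the factorisation is recorded, as this is what [null_mod_retract] consumes. *)
Lemma tpow_map_split (X Y : complex R) (f : chain_map X Y) (t s : nat) :
  exists (a : chain_map (tpow X (t + s.+1).+1) (tcomplex (tpow X t.+1) (tpow X s.+1)))
         (b : chain_map (tcomplex (tpow Y t.+1) (tpow Y s.+1)) (tpow Y (t + s.+1).+1)),
  forall n x, tpow_map f (t + s.+1).+1 n x =
    b n (tcmap (tpow_map f t.+1) (tpow_map f s.+1) n (a n x)).
Proof.
elim: t => [|t [a [b IH]]].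
  (* For one factor on the left the splitting is the recursive clause of [tpow_map]. *)
  by exists (id_map _), (id_map _).
exists (comp_map (assocl_map X (tpow X t.+1) (tpow X s.+1)) (tcmap (id_map X) a)).
exists (comp_map (tcmap (id_map Y) b) (assocr_map Y (tpow Y t.+1) (tpow Y s.+1))).
move=> n x; pose g := tcmap (tpow_map f t.+1) (tpow_map f s.+1).
have E : tcmap f (tpow_map f (t + s.+1).+1) n x =
    tcmap (id_map Y) b n (tcmap f (comp_map g a) n x).
  exact: tcmap_comp.
apply: (etrans E).
have -> : tcmap f (comp_map g a) n x = tcmap f g n (tcmap (id_map X) a n x).
  exact: tcmap_comp.
apply: (congr1 (tcmap (id_map Y) b n)); apply: (etrans (esym (assoclK _))).
exact: congr1 (assocl_natural _ _ _ _).
Qed.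

Lemma tpow_projective (X : complex R) : (forall i, fin_gen (X i)) ->
  (forall i, projective (X i)) -> forall t i, projective (tpow X t.+1 i).
Proof.
by move=> gX pX; elim=> [|t IH] i //; apply: tob_projective.
Qed.

Lemma null_mod_tpowD (I J K : set R) (X Y : complex R) (f : chain_map X Y) t s :
  (forall a b, I a -> J b -> K (a * b)) ->
  null_mod I (tpow_map f t.+1) -> null_mod J (tpow_map f s.+1) ->
  null_mod K (tpow_map f (t + s.+1).+1).
Proof.
move=> IJK nI nJ; have [a [b ab]] := tpow_map_split f t s.
exact: null_mod_retract ab (null_mod_tens IJK nI nJ).
Qed.

End TensorPowers.

(** * The unit $m \mapsto m \otimes 1$ of base change *)

Section BaseChangeUnit.
Variables (R S : comPzRingType) (phi : {rmorphism R -> S}).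

Definition bchg1 (M : lmodType R) (m : M) : bchg phi M := pure m (1 : restr phi).

Lemma bchg1D (M : lmodType R) (m m' : M) : bchg1 (m + m') = bchg1 m + bchg1 m'.
Proof. exact: pureDl. Qed.
Lemma bchg10 (M : lmodType R) : bchg1 (0 : M) = 0.
Proof. exact: pure0l. Qed.

Lemma bchg_scaleE (M : lmodType R) s (m : M) (x : restr phi) :
  s *: (pure m x : bchg phi M) = pure m (s * (x : S) : restr phi).
Proof. exact: bchg_scale_pure. Qed.

Lemma bchg1Z (M : lmodType R) a (m : M) : bchg1 (a *: m) = phi a *: bchg1 m.
Proof.
rewrite /bchg1 bchg_scaleE mulr1 pureZl -pureZr; congr (pure _ _).
by rewrite /GRing.scale /= /restr_scale mulr1.
Qed.

Lemma bchg1N (M : lmodType R) (m : M) : bchg1 (- m) = - bchg1 m.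
Proof. by rewrite -scaleN1r bchg1Z rmorphN rmorph1 scaleN1r. Qed.

Lemma bchg1_sum (M : lmodType R) n (F : 'I_n -> M) :
  bchg1 (\sum_k F k) = \sum_k bchg1 (F k).
Proof. by elim/big_rec2: _ => [|k u w _ <-]; [exact: bchg10|rewrite bchg1D]. Qed.

Lemma bchg_map1 (M N : lmodType R) (f : {linear M -> N}) m :
  bchg_map phi f (bchg1 m) = bchg1 (f m).
Proof. exact: bchg_map_pure. Qed.

Section Functional.
Variables (M : lmodType R) (c : {linear M -> R^o}).
Definition functional_fun (m : M) (x : restr phi) : restr phi :=
  phi (c m : R) * (x : S).
Fact functional_linl x : linear (functional_fun^~ x).
Proof.
move=> a m m'; rewrite /functional_fun linearP rmorphD rmorphM mulrDl.
by rewrite -mulrA.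
Qed.
Fact functional_linr m : linear (functional_fun m).
Proof.
move=> a x x'; rewrite /functional_fun mulrDr; congr (_ + _).
by rewrite /GRing.scale /= /restr_scale mulrCA.
Qed.
Definition functional : {linear tens M (restr phi) -> restr phi} :=
  tens_lift (MkBilin functional_linl functional_linr).
Lemma functional1 m : functional (bchg1 m) = phi (c m).
Proof. by rewrite /functional /= tens_liftE /= /functional_fun mulr1. Qed.
End Functional.

End BaseChangeUnit.

(** * Clearing denominators over the residue field *)

Section ResidueField.
Variables (R : comPzRingType) (p : Spec R).
Local Notation phi := (to_kappa p).

(** The base-changed functionals of a dual basis send $m \otimes 1$ to the images of the coordinates
    of $m$, and $p$ is the kernel of $R \to \kappa(p)$. *)
Lemma bchg1_eq0 (M : lmodType R) (m : M) : fin_gen M -> projective M ->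
  bchg1 phi m = 0 -> idmul p m.
Proof.
move=> gM pM m0; have [n [v [c vc]]] := fg_projective_dual_basis gM pM.
rewrite (vc m); apply: idmul_sum => k; apply: idmulZ; apply/to_kappa_eq0.
by rewrite -functional1 m0 linear0.
Qed.

Lemma prime_mul (s t : R) : ~ p s -> ~ p t -> ~ p (s * t).
Proof. by move=> ps pt; have [_ _ pP] := Defs.primeP p; case/pP. Qed.

Lemma kappa_denominator (x : kappa p) :
  exists2 s, ~ p s & exists a, phi s * x = phi a.
Proof.
rewrite -[x]reprK; elim/loc_ind: (repr x) => a [s ps]; exists s => //; exists a.
rewrite /to_kappa -rmorphM fracM; congr (\pi _)%qT.
by apply/fracP; exists (denom1 p); rewrite /=; ring.
Qed.

Lemma bchg_denominator (M : lmodType R) (z : bchg phi M) :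
  exists2 s, ~ p s & exists m, phi s *: z = bchg1 phi m.
Proof.
elim/bchg_ind: z => [|z w [s ps [m zm]] [t pt [m' wm']]|m x].
- exists 1; first by have [] := Defs.primeP p.
  by exists 0; rewrite scaler0 bchg10.
- exists (s * t); first exact: prime_mul.
  exists (t *: m + s *: m'); rewrite bchg1D !bchg1Z -zm -wm' scalerDr !scalerA.
  by rewrite !rmorphM (mulrC (phi t)).
have [s ps [a sa]] := kappa_denominator x; exists s => //; exists (a *: m).
by rewrite bchg_scaleE sa bchg1Z bchg_scaleE mulr1.
Qed.

Lemma bchg_denominator_fin (M : lmodType R) n (z : 'I_n -> bchg phi M) :
  exists2 s, ~ p s & exists m : 'I_n -> M, forall k, phi s *: z k = bchg1 phi (m k).
Proof.
have hs k : exists2 s, ~ p s & exists m, phi s *: z k = bchg1 phi m.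
  exact: bchg_denominator.
have [d hd] := choice (fun k => let: ex_intro2 s ps m := hs k in
  ex_intro (fun s => ~ p s /\ exists m, phi s *: z k = bchg1 phi m) s (conj ps m)).
have [m hm] := choice (fun k => (hd k).2).
exists (\prod_k d k).
  apply: (big_ind (fun s => ~ p s)) => [||k _]; last exact: (hd k).1.
    by have [] := Defs.primeP p.
  exact: prime_mul.
exists (fun k => (\prod_(j | j != k) d j) *: m k) => k.
by rewrite bchg1Z -hm scalerA -rmorphM mulrC [in LHS](bigD1 k).
Qed.

Section DualSum.
Variables (M N : lmodType R) (n : nat).
Variables (c : 'I_n -> {linear M -> R^o}) (y : 'I_n -> N).
Definition dual_sum (x : M) : N := \sum_k (c k x : R) *: y k.
Fact dual_sum_linear : linear dual_sum.
Proof.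
move=> a u v; rewrite /dual_sum scaler_sumr -big_split /=.
by apply: eq_bigr => k _; rewrite linearP scalerDl scalerA.
Qed.
HB.instance Definition _ := GRing.isLinear.Build R M N *:%R dual_sum dual_sum_linear.
End DualSum.

(** A common denominator for the finitely many values $H(v_k \otimes 1)$ suffices; the numerators
    are extended linearly by the dual basis. *)
Lemma linear_denominator (M N : lmodType R)
    (H : {linear bchg phi M -> bchg phi N}) : fin_gen M -> projective M ->
  exists2 s, ~ p s & exists h : {linear M -> N},
    forall x, phi s *: H (bchg1 phi x) = bchg1 phi (h x).
Proof.
move=> gM pM; have [n [v [c vc]]] := fg_projective_dual_basis gM pM.
have [s ps [y hy]] := bchg_denominator_fin (fun k => H (bchg1 phi (v k))).
exists s => //; exists (dual_sum c y) => x.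
rewrite [in LHS](vc x) /= /dual_sum !bchg1_sum linear_sum scaler_sumr.
by apply: eq_bigr => k _; rewrite !bchg1Z linearZ /= -hy !scalerA mulrC.
Qed.

Lemma bchg_trivial (M : lmodType R) (z : bchg phi M) : (forall x : M, x = 0) -> z = 0.
Proof.
move=> M0; elim/bchg_ind: z => // [x y -> ->|m x]; first exact: addr0.
by rewrite (M0 m) pure0l.
Qed.

(** Boundedness of $Y$ leaves finitely many degrees whose denominators must be multiplied together;
    in all others the target vanishes and the zero map serves. *)
Lemma family_denominator (X Y : complex R)
    (H : forall i, {linear bchg phi (X (i + 1)) -> bchg phi (Y i)}) :
  (forall i, fin_gen (X i) /\ projective (X i)) -> in_Kb Y ->
  exists2 s, ~ p s & exists h : forall i, {linear X (i + 1) -> Y i},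
    forall i x, phi s *: H i (bchg1 phi x) = bchg1 phi (h i x).
Proof.
move=> hX [_ [N hN]].
pose Q i s := exists h : {linear X (i + 1) -> Y i},
  forall x, phi s *: H i (bchg1 phi x) = bchg1 phi (h x).
have QM i s t : Q i s -> Q i (t * s).
  move=> [h hh]; exists (t \*: h) => x /=.
  by rewrite bchg1Z -hh scalerA rmorphM.
have Q1 i : exists2 s, ~ p s & Q i s by have [] := hX (i + 1); apply: linear_denominator.
have [s ps hs] : exists2 s, ~ p s & forall i, Q i s.
  suff [s ps hs] : exists2 s, ~ p s & forall i, (absz i <= absz N)%N -> Q i s.
    exists s => // i; have [|iN] := leqP (absz i) (absz N); first exact: hs.
    exists \0 => x; rewrite /= bchg10 [X in _ *: X]bchg_trivial ?scaler0 //.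
    by apply: hN; lia.
  (* Raising the bound from $n$ to $n + 1$ adds the two degrees $\pm(n + 1)$, with denominators [t]
     and [u]. *)
  elim: (absz N) => [|n [s ps hs]].
    have [s ps hs] := Q1 0; exists s => // i i0; have -> : i = 0 by lia.
    exact: hs.
  have [t pt ht] := Q1 (n.+1 : int); have [u pu hu] := Q1 (- (n.+1 : int)).
  exists (u * (t * s)); first by do !apply: prime_mul.
  move=> i le_i; have [le_in|lt_ni] := leqP (absz i) n.
    by do !apply: (QM); apply: hs.
  have [->|->] : i = n.+1 \/ i = - (n.+1 : int) by lia.
    by apply: (QM); rewrite mulrC; apply: (QM).
  by rewrite mulrC; apply: QM.
exists s => //; exists (fun i => sval (cid (hs i))) => i.
exact: (svalP (cid (hs i))).
Qed.

(** Multiplying the homotopy over $\kappa(p)$ by a common denominator makes it come from $R$. Then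
    $s f - dh - hd$ dies in $Y \otimes \kappa(p)$, so it takes values in $pY$. *)
Lemma null_mod_residue (X Y : complex R) (f : chain_map X Y) :
  (forall i, fin_gen (X i) /\ projective (X i)) -> in_Kb Y ->
  homotopic (cbchg_map phi f) (zero_map (cbchg phi X) (cbchg phi Y)) ->
  exists2 s, ~ p s & null_mod p (fun i => s \*: f i).
Proof.
move=> hX hY [H hH]; have [s ps [h hh]] := family_denominator H hX hY.
exists s => //; exists h => i x; have [gY pY] := hY.1 (i + 1).
apply: bchg1_eq0 => //.
have := congr1 (fun z => phi s *: z) (hH i (bchg1 phi x)).
rewrite /= subr0 scalerDr.
have -> : phi s *: bchg_map phi (diff Y i) (H i (bchg1 phi x)) =
    bchg_map phi (diff Y i) (phi s *: H i (bchg1 phi x)) by rewrite linearZ.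
rewrite !bchg_map1 !hh bchg_map1 -bchg1Z.
by rewrite bchg1D bchg1N bchg1D => ->; rewrite subrr.
Qed.

End ResidueField.

(** * Noetherian maximality and the final argument *)

(** Otherwise choice builds a strictly ascending chain of ideals satisfying [P], whose union is
    finitely generated. *)
Lemma noetherian_maximal (R : comPzRingType) (P : set R -> Prop) (I0 : set R) :
  noetherian R -> is_ideal I0 -> P I0 ->
  exists I, [/\ is_ideal I, P I &
    forall J, is_ideal J -> P J -> I `<=` J -> J `<=` I].
Proof.
move=> hR iI0 PI0; apply: contrapT => noMax.
pose T := {I : set R | is_ideal I /\ P I}.
have next (I : T) : {J : T | sval I `<=` sval J /\ ~ (sval J `<=` sval I)}.
  apply: cid; apply: contrapT => noJ; apply: noMax; exists (sval I).
  have [iI PI] := svalP I; split=> // J iJ PJ IJ; apply: contrapT => nJI.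
  by apply: noJ; exists (exist _ J (conj iJ PJ)).
pose chain n : T := iter n (fun I => sval (next I)) (exist _ I0 (conj iI0 PI0)).
have chainS n : sval (chain n) `<=` sval (chain n.+1).
  by have [] := svalP (next (chain n)).
have chain_le m n : (m <= n)%N -> sval (chain m) `<=` sval (chain n).
  move=> /subnK <-; elim: (n - m)%N => // k IH.
  by apply: subset_trans IH _; apply: chainS.
pose U : set R := [set x | exists n, sval (chain n) x].
have iU : is_ideal U.
  split=> [|x y [m hx] [n hy]|a x [n hx]].
  - by exists 0%N; have [[]] := svalP (chain 0%N).
  - exists (maxn m n); have [[_ hD _] _] := svalP (chain (maxn m n)).
    apply: hD; first by apply: chain_le hx; apply: leq_maxl.
    by apply: chain_le hy; apply: leq_maxr.
  - by exists n; have [[_ _ hM] _] := svalP (chain n); apply: hM.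
have [n [v Uv]] := hR U iU.
have vU k : U (v k).
  rewrite Uv; exists (fun j => (j == k)%:R); rewrite (bigD1 k) //= eqxx mul1r.
  by rewrite big1 ?addr0 // => j /negPf ->; rewrite mul0r.
have [d hd] := choice vU.
pose N := (\max_k d k)%N.
(* All generators of the union lie in the ideal at stage [N], so the chain cannot grow at stage $N +
   1$. *)
have [] := svalP (next (chain N)) => _; apply.
apply: (@subset_trans _ U) => [x hx|]; first by exists N.+1.
rewrite Uv => _ [c ->]; have [[h0 hD hM] _] := svalP (chain N).
apply: (big_ind (sval (chain N))) => // k _; apply: hM.
by apply: chain_le (hd k); apply: leq_bigmax.
Qed.

Theorem theorem2p7 (R : comPzRingType) (hR : noetherian R)
    (X Y : complex R) (hX : in_Kminus X) (hY : in_Kb Y) (f : chain_map X Y)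
    (hf : forall p : Spec R,
      homotopic (cbchg_map (to_kappa p) f)
        (zero_map (cbchg (to_kappa p) X) (cbchg (to_kappa p) Y))) :
  exists t : nat,
    (0 < t)%N /\ homotopic (tpow_map f t) (zero_map (tpow X t) (tpow Y t)).
Proof.
(* The exponent $t + 1$ keeps the power positive and avoids the unit complex. *)
pose nilp (I : set R) := exists t, null_mod I (tpow_map f t.+1).
have gX i : fin_gen (X i) by have [] := hX.1 i.
have pX i : projective (X i) by have [] := hX.1 i.
have gY i : fin_gen (Y i) by have [] := hY.1 i.
have pY i : projective (Y i) by have [] := hY.1 i.
suff [t [h hh]] : nilp [set 0].
  exists t.+1; split=> //; exists h => i x; rewrite [zero_map _ _ _ _]/= subr0.
  by apply/subr0_eq; apply: idmul_set0 (hh i x).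
have i0 : is_ideal [set 0 : R].
  by split=> [|x y /= -> ->|a x /= ->]; rewrite /= ?addr0 ?mulr0.
apply: contrapT => n0.
have [I [iI nI maxI]] := noetherian_maximal (P := fun I => ~ nilp I) hR i0 n0.
have [I0 ID IM] := iI.
have nilp_adjoin s : ~ I s -> nilp (ideal_adjoin I s).
  move=> nIs; apply: contrapT => nJ; apply: nIs.
  apply: (maxI _ (ideal_adjoin_ideal s iI) nJ).
    by move=> x Ix; exists x => //; exists 0; rewrite mul0r addr0.
  by exists 0 => //; exists 1; rewrite mul1r add0r.
(* Modulo the unit ideal every map is null by the zero homotopy. *)
have I1 : ~ I 1.
  move=> I1; apply: nI; exists 0%N, (fun i => \0) => i x.
  by rewrite -[X in idmul _ X]scale1r; apply: idmulZ.
have primeI : is_prime I.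
  (* If $xy \in I$ then $(I + (x))(I + (y)) \subseteq I$, so the powers that are null modulo the two
     factors multiply to one that is null modulo $I$. *)
  split=> // x y Ixy; apply: contrapT => /not_orP[/nilp_adjoin[t nt] /nilp_adjoin[s ns]].
  apply: nI; exists (t + s.+1)%N; apply: null_mod_tpowD nt ns.
  move=> _ _ [a Ia [r ->]] [b Ib [q ->]].
  have -> : (a + r * x) * (b + q * y) =
    (b + q * y) * a + (r * x * b + r * q * (x * y)) by ring.
  by apply: (ID); [apply: IM|apply: ID; apply: IM].
pose p := MkSpec primeI.
have [s ps ns] := null_mod_residue hX.1 hY (hf p).
have [t nt] := nilp_adjoin s ps.
(* The next power is $f \otimes f^{\otimes(t+1)}$ by definition. *)
apply: nI; exists t.+1.
apply: (@null_mod_prime_step R p s X Y _ _ f (tpow_map f t.+1) ps) => // i;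
  exact: tpow_projective.
Qed.
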